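(* Let $n\ge 2$. Then the set $\mathcal{S}^0_n$ of all graphons $S(n,f)$ on the sphere $S_n$, where $f:[-1,1]\to\mathbb{R}$ ranges over measurable functions with $0\le f(x)\le 1$ for all $x\in[-1,1]$, is compact in the cut norm.
   Context: $S_n=\{x\in\mathbb{R}^{n+1}:\|x\|_2=1\}$ with the uniform (rotation invariant) probability measure $\mu$. For a bounded measurable $f:[-1,1]\to\mathbb{R}$, $S(n,f)$ is the kernel $W:S_n\times S_n\to\mathbb{R}$, $W(x,y)=f(x\cdot y)$, with $x\cdot y$ the usual scalar product; kernels equal almost everywhere are identified. The cut norm of $M\in L_2(S_n\times S_n)$ is $\|M\|_\square=\sup\bigl|\iint\overline{f(x)}M(x,y)g(y)\,d\mu(x)\,d\mu(y)\bigr|$ over measurable $f,g:S_n\to\mathbb{C}$ with $\|f\|_\infty,\|g\|_\infty\le 1$. *)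

(* Defs.v *)
From HB Require Import structures.
From mathcomp Require Import all_boot all_order all_algebra.
From mathcomp Require Import all_classical all_reals all_analysis.
From mathcomp Require Import ess_sup_inf measurable_realfun complex.
From mathcomp Require Import ring lra.

Set Implicit Arguments.
Unset Strict Implicit.
Unset Printing Implicit Defensive.
Import Order.TTheory GRing.Theory Num.Theory.
Import numFieldNormedType.Exports.
Import Normc.

Local Open Scope classical_set_scope.
Local Open Scope ring_scope.
Local Open Scope complex_scope.

Section cut_norm_def.
Context d (T : measurableType d) (R : realType).

Definition complex_measurable (f : T -> R[i]) : Prop :=
  measurable_fun [set: T] (fun x => complex.Re (f x)) /\
  measurable_fun [set: T] (fun x => complex.Im (f x)).

Definition complex_integral (mu : {measure set T -> \bar R})
    (f : T -> R[i]) : R[i] :=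
  Rintegral mu [set: T] (fun x => complex.Re (f x)) +i*
  Rintegral mu [set: T] (fun x => complex.Im (f x)).

(* measurable f : T -> C with `||f||_oo <= 1` *)
Definition cut_test (mu : probability T R) : set (T -> R[i]) :=
  [set f | complex_measurable f /\
           (ess_sup mu (fun x => (normc (f x))%:E) <= 1)%E].

End cut_norm_def.

Section cut_norm.
Context d (T : measurableType d) (R : realType) (mu : probability T R).

Definition cut_form (M : T * T -> R) (f g : T -> R[i]) : R[i] :=
  complex_integral (mu \x mu)%E (fun z => (f z.1)^* * (M z)%:C * g z.2).

Definition cut_norm (M : T * T -> R) : R :=
  sup [set normc (cut_form M p.1 p.2) | p in cut_test mu `*` cut_test mu].

Definition L2_kernel : Type := LspaceType2 (mu \x mu)%E.
HB.instance Definition _ := gen_eqMixin L2_kernel.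
HB.instance Definition _ := gen_choiceMixin L2_kernel.

Definition kernel_fun (M : L2_kernel) : T * T -> R := (M : LspaceType2 _).

Local Notation nu := (mu \x mu)%E.
Definition cut_weight (f g : T -> R[i]) (z : T * T) : R[i] :=
  (f z.1)^* * g z.2.
Local Notation wt := cut_weight.

Lemma ReZ (a b : R[i]) (m : R) :
  complex.Re (a^* * m%:C * b) = complex.Re (a^* * b) * m.
Proof. by case: a b => [a1 a2] [b1 b2] /=; ring. Qed.

Lemma ImZ (a b : R[i]) (m : R) :
  complex.Im (a^* * m%:C * b) = complex.Im (a^* * b) * m.
Proof. by case: a b => [a1 a2] [b1 b2] /=; ring. Qed.

Lemma cut_formE M f g : cut_form M f g =
  Rintegral nu [set: T * T] (fun z => complex.Re (wt f g z) * M z) +i*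
  Rintegral nu [set: T * T] (fun z => complex.Im (wt f g z) * M z).
Proof.
by rewrite /cut_form /complex_integral; congr (_ +i* _);
  apply: eq_Rintegral => z _; rewrite ?ReZ ?ImZ.
Qed.

Lemma Re_le (a : R[i]) : `|complex.Re a| <= normc a.
Proof.
by case: a => a b /=; rewrite -sqrtr_sqr ler_wsqrtr// lerDl sqr_ge0.
Qed.

Lemma Im_le (a : R[i]) : `|complex.Im a| <= normc a.
Proof.
by case: a => a b /=; rewrite -sqrtr_sqr ler_wsqrtr// lerDr sqr_ge0.
Qed.

Lemma normc_ge0 (a : R[i]) : 0 <= normc a.
Proof. by case: a => a b; rewrite sqrtr_ge0. Qed.

Lemma normc_conj (a : R[i]) : normc a^* = normc a.
Proof. by case: a => a b /=; rewrite sqrrN. Qed.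

Lemma ae_fst (P : T -> Prop) : {ae mu, forall x, P x} ->
  {ae nu, forall z : T * T, P z.1}.
Proof.
move=> [N [mN N0 PN]]; exists (N `*` setT); split.
- exact: measurableX.
- transitivity (mu N * mu setT)%E; first exact: product_measure1E.
  by rewrite N0 mul0e.
- by move=> z /= Pz; split => //; exact: PN.
Qed.

Lemma ae_snd (P : T -> Prop) : {ae mu, forall x, P x} ->
  {ae nu, forall z : T * T, P z.2}.
Proof.
move=> [N [mN N0 PN]]; exists (setT `*` N); split.
- exact: measurableX.
- transitivity (mu setT * mu N)%E; first exact: product_measure1E.
  by rewrite N0 mule0.
- by move=> z /= Pz; split => //; exact: PN.
Qed.

Lemma wt_le1 f g : cut_test mu f -> cut_test mu g ->
  {ae nu, forall z, normc (wt f g z) <= 1}.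
Proof.
move=> [_ /ess_supP/ae_fst f1] [_ /ess_supP/ae_snd g1].
apply: filterS2 f1 g1 => z; rewrite !lee_fin => f1 g1.
by rewrite /cut_weight normcM normc_conj mulr_ile1// normc_ge0.
Qed.

Lemma measurable_Re_wt f g : cut_test mu f -> cut_test mu g ->
  measurable_fun [set: T * T] (fun z => complex.Re (wt f g z)).
Proof.
move=> [[f1 f2] _] [[g1 g2] _].
rewrite (_ : (fun _ => _) = (fun z : T * T =>
    complex.Re (f z.1) * complex.Re (g z.2)
  + complex.Im (f z.1) * complex.Im (g z.2))); last first.
  apply/funext => z; rewrite /cut_weight.
  by case: (f _) (g _) => [a1 a2] [b1 b2] /=; ring.
apply: measurable_funD; apply: measurable_funM.
- exact: (measurableT_comp f1 measurable_fst).
- exact: (measurableT_comp g1 measurable_snd).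
- exact: (measurableT_comp f2 measurable_fst).
- exact: (measurableT_comp g2 measurable_snd).
Qed.

Lemma measurable_Im_wt f g : cut_test mu f -> cut_test mu g ->
  measurable_fun [set: T * T] (fun z => complex.Im (wt f g z)).
Proof.
move=> [[f1 f2] _] [[g1 g2] _].
rewrite (_ : (fun _ => _) = (fun z : T * T =>
    complex.Re (f z.1) * complex.Im (g z.2)
  - complex.Im (f z.1) * complex.Re (g z.2))); last first.
  apply/funext => z; rewrite /cut_weight.
  by case: (f _) (g _) => [a1 a2] [b1 b2] /=; ring.
apply: measurable_funB; apply: measurable_funM.
- exact: (measurableT_comp f1 measurable_fst).
- exact: (measurableT_comp g2 measurable_snd).
- exact: (measurableT_comp f2 measurable_fst).
- exact: (measurableT_comp g1 measurable_snd).
Qed.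

Local Notation integrable_kernel M :=
  (nu.-integrable [set: T * T] (EFin \o (M : T * T -> R))).

Lemma le_wtM (w M : T * T -> R) : measurable_fun [set: T * T] w ->
  {ae nu, forall z, `|w z| <= 1} -> integrable_kernel M ->
  (\int[nu]_z `|(w z * M z)%:E| <= \int[nu]_z `|(M z)%:E|)%E.
Proof.
move=> mw w1 iM; have mM := measurable_int _ iM.
apply: ae_ge0_le_integral => //.
- apply: measurableT_comp => //; apply/measurable_EFinP/measurable_funM => //.
  exact/measurable_EFinP.
- exact: measurableT_comp.
- apply: filterS w1 => z w1 _ /=.
  by rewrite lee_fin normrM ler_piMl.
Qed.

Lemma integrable_wtM (w M : T * T -> R) : measurable_fun [set: T * T] w ->
  {ae nu, forall z, `|w z| <= 1} -> integrable_kernel M ->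
  integrable_kernel (fun z => w z * M z).
Proof.
move=> mw w1 iM; have /integrableP[mM Moo] := iM.
apply/integrableP; split.
  by apply/measurable_EFinP/measurable_funM => //; exact/measurable_EFinP.
by apply: le_lt_trans Moo; exact: le_wtM.
Qed.

Lemma abs_int_wtM (w M : T * T -> R) : measurable_fun [set: T * T] w ->
  {ae nu, forall z, `|w z| <= 1} -> integrable_kernel M ->
  `|Rintegral nu setT (fun z => w z * M z)| <=
    Rintegral nu setT (fun z => `|M z|).
Proof.
move=> mw w1 iM; have iw := integrable_wtM mw w1 iM.
apply: (le_trans (le_normr_Rintegral measurableT iw)).
apply: fine_le; last exact: le_wtM.
- by apply: integrable_fin_num => //; exact: (integrable_abse iw).
- by apply: integrable_fin_num => //; exact: (integrable_abse iM).
Qed.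

Lemma Re_wt1 f g : cut_test mu f -> cut_test mu g ->
  {ae nu, forall z, `|complex.Re (wt f g z)| <= 1}.
Proof.
by move=> tf tg; apply: filterS (wt_le1 tf tg) => z; apply: le_trans (Re_le _).
Qed.

Lemma Im_wt1 f g : cut_test mu f -> cut_test mu g ->
  {ae nu, forall z, `|complex.Im (wt f g z)| <= 1}.
Proof.
by move=> tf tg; apply: filterS (wt_le1 tf tg) => z; apply: le_trans (Im_le _).
Qed.

Lemma cut_formD M N f g : cut_test mu f -> cut_test mu g ->
  integrable_kernel M -> integrable_kernel N ->
  cut_form (fun z => M z + N z) f g = cut_form M f g + cut_form N f g.
Proof.
move=> tf tg iM iN; rewrite !cut_formE; apply/eqP; rewrite eq_complex /=.
apply/andP; split; apply/eqP; under eq_Rintegral do rewrite mulrDr;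
  rewrite RintegralD//; by
  [apply: integrable_wtM => //;
    [exact: measurable_Re_wt|exact: Re_wt1]
  |apply: integrable_wtM => //;
    [exact: measurable_Im_wt|exact: Im_wt1]].
Qed.

Lemma cut_formN M f g : cut_test mu f -> cut_test mu g ->
  integrable_kernel M -> cut_form (fun z => - M z) f g = - cut_form M f g.
Proof.
move=> tf tg iM; rewrite !cut_formE; apply/eqP; rewrite eq_complex /=.
apply/andP; split; apply/eqP; rewrite -mulN1r -RintegralZl//; by
  [apply: eq_Rintegral => z _; ring
  |apply: integrable_wtM => //;
    [exact: measurable_Re_wt|exact: Re_wt1]
  |apply: integrable_wtM => //;
    [exact: measurable_Im_wt|exact: Im_wt1]].
Qed.

Lemma cut_form_bound M f g : cut_test mu f -> cut_test mu g ->
  integrable_kernel M ->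
  normc (cut_form M f g) <= Rintegral nu setT (fun z => `|M z|) *+ 2.
Proof.
move=> tf tg iM; rewrite cut_formE.
have h1 := abs_int_wtM (measurable_Re_wt tf tg) (Re_wt1 tf tg) iM.
have h2 := abs_int_wtM (measurable_Im_wt tf tg) (Im_wt1 tf tg) iM.
rewrite mulr2n; apply: le_trans (lerD h1 h2) => /=.
set a := Rintegral _ _ _; set b := Rintegral _ _ _.
rewrite -[leRHS]ger0_norm ?addr_ge0// -sqrtr_sqr ler_wsqrtr//.
by rewrite sqrrD !real_normK ?num_real// -addrA lerD2l lerDr mulrn_wge0// mulr_ge0.
Qed.

Lemma cut_test0 : cut_test mu (fun=> 0).
Proof.
split; first by split; exact: measurable_cst.
by apply/ess_supP; apply: aeW => x /=; rewrite expr0n addr0 sqrtr0 lee_fin.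
Qed.

Lemma le_cut_norm M f g : cut_test mu f -> cut_test mu g ->
  integrable_kernel M -> normc (cut_form M f g) <= cut_norm M.
Proof.
move=> tf tg iM; apply: ub_le_sup; last by exists (f, g).
exists (Rintegral nu setT (fun z => `|M z|) *+ 2) => _ [[f' g'] [/= tf' tg'] <-].
exact: cut_form_bound.
Qed.

Lemma cut_norm_le M c :
  (forall f g, cut_test mu f -> cut_test mu g -> normc (cut_form M f g) <= c) ->
  cut_norm M <= c.
Proof.
move=> h; apply: ge_sup.
  by eexists; exists (fun=> 0, fun=> 0); [split; exact: cut_test0|reflexivity].
by move=> _ [[f g] [/= tf tg] <-]; exact: h.
Qed.

Lemma cut_normD M N : integrable_kernel M -> integrable_kernel N ->
  cut_norm (fun z => M z + N z) <= cut_norm M + cut_norm N.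
Proof.
move=> iM iN; apply: cut_norm_le => f g tf tg; rewrite cut_formD//.
by apply: (le_trans (le_normcD _ _)); rewrite lerD// le_cut_norm.
Qed.

Lemma cut_normN M : integrable_kernel M ->
  cut_norm (fun z => - M z) <= cut_norm M.
Proof.
move=> iM; apply: cut_norm_le => f g tf tg; rewrite cut_formN//.
rewrite (_ : normc _ = normc (cut_form M f g)) ?le_cut_norm//.
by case: (cut_form _ _ _) => a b /=; rewrite !sqrrN.
Qed.

Lemma cut_test_indic A : measurable A -> cut_test mu (fun x => (\1_A x)%:C).
Proof.
move=> mA; split; first by split => /=; [exact: measurable_indic|exact: measurable_cst].
apply/ess_supP; apply: aeW => x /=.
by rewrite expr0n addr0 sqrtr_sqr lee_fin ger0_norm// indicE lern1 leq_b1.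
Qed.

Lemma cut_norm0_rect M A B : integrable_kernel M -> cut_norm M = 0 ->
  measurable A -> measurable B -> (\int[nu]_(z in A `*` B) (M z)%:E = 0)%E.
Proof.
move=> iM M0 mA mB.
have := le_cut_norm (cut_test_indic mA) (cut_test_indic mB) iM.
rewrite M0 => h.
have /eq0_normc : normc (cut_form M (fun x => (\1_A x)%:C) (fun x => (\1_B x)%:C)) = 0.
  by apply/eqP; rewrite eq_le h normc_ge0.
rewrite cut_formE => -[+ _].
have -> : (fun z => complex.Re (wt (fun x => (\1_A x)%:C) (fun x => (\1_B x)%:C) z) * M z)
   = (M \_ (A `*` B)).
  apply/funext => z; rewrite patch_indic/= /cut_weight/= !indicE in_setX -mulnb natrM.
  by ring.
rewrite -Rintegral_mkcond /Rintegral => h0.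
have mAB : measurable (A `*` B) by exact: measurableX.
have iAB : nu.-integrable (A `*` B) (EFin \o M) by exact: integrableS iM.
by move: (integrable_fin_num mAB iAB) => /fineK <-; rewrite h0.
Qed.

Lemma cut_norm0_ae M : integrable_kernel M -> cut_norm M = 0 ->
  {ae nu, forall z, M z = 0}.
Proof.
move=> iM M0.
have iS (S : set (T * T)) : measurable S -> nu.-integrable S (EFin \o M).
  by move=> mS; exact: integrableS iM.
have h (S : set (T * T)) : measurable S ->
    (\int[nu]_(z in S) (M z)%:E = 0)%E.
  move=> mS; have := mS; rewrite {1}measurable_prod_measurableType.
  apply: (dynkin_induction (P := fun S => (\int[nu]_(z in S) (M z)%:E = 0)%E)
    (measurable_prod_measurableType T T)).
  - move=> _ _ [A mA [B mB <-]] [C mC [D mD <-]]; rewrite -setXI.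
    by exists (A `&` C); [exact: measurableI|exists (B `&` D) => //; exact: measurableI].
  - by rewrite -setXTT; exact: cut_norm0_rect.
  - by move=> _ [A mA [B mB <-]]; exact: cut_norm0_rect.
  - move=> U mU U0.
    have := @integral_setU _ _ _ nu U (~` U) (EFin \o M) mU (measurableC mU).
    rewrite setUv U0 add0e -setXTT cut_norm0_rect// => <- //.
      by rewrite setXTT; exact: measurable_int iM.
    by apply/disj_setPS; rewrite setICr.
  - move=> F mF tF F0; rewrite integral_bigcup//.
      by rewrite eseries0// => i _ _; exact: F0.
    by apply: iS; exact: bigcupT_measurable.
have := @integral_ae_eq _ _ _ nu setT measurableT (cst 0%E) (EFin \o M) iM.
move=> /(_ (measurable_cst _)) H.
have : ae_eq nu setT (EFin \o M) (cst 0%E).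
  by apply: H => E _ mE; rewrite h// integral0.
by apply: filterS => z /(_ I) [].
Qed.

Lemma integrable_L2 (M : L2_kernel) : integrable_kernel (kernel_fun M).
Proof.
have nuT : nu [set: T * T] \is a fin_num.
  suff -> : nu setT = 1%E by [].
  rewrite -setXTT; transitivity (mu setT * mu setT)%E.
    exact: product_measure1E.
  by rewrite probability_setT mule1.
apply/Lfun1_integrable/(Lfun_subset12 nuT).
rewrite inE; apply/andP; split; rewrite inE/=.
  rewrite /kernel_fun /aqEqMfun_to_fun; set F := repr _ => mT Y mY.
  exact: (measurable_funP F mT Y mY).
exact: (@Lebesgue_finite _ _ _ _ _ _ (M : LspaceType2 _)).
Qed.

Lemma integrable_L2B (M N : L2_kernel) :
  integrable_kernel (fun z => kernel_fun M z - kernel_fun N z).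
Proof. exact: (integrableB measurableT (integrable_L2 M) (integrable_L2 N)). Qed.

Definition cut_dist (M N : L2_kernel) : R :=
  cut_norm (fun z => kernel_fun M z - kernel_fun N z).

Lemma cut_distxx M : cut_dist M M = 0.
Proof.
have i0 : integrable_kernel (fun z => kernel_fun M z - kernel_fun M z).
  exact: integrable_L2B.
apply/eqP; rewrite eq_le; apply/andP; split.
  apply: cut_norm_le => f g tf tg; rewrite cut_formE.
  rewrite (_ : (fun z => _ * _) = cst 0); last by apply/funext => z /=; ring.
  rewrite (_ : (fun z => _ * _) = cst 0); last by apply/funext => z /=; ring.
  by rewrite /= !Rintegral_cst// !mul0r expr0n addr0 sqrtr0.
by apply: le_trans (le_cut_norm cut_test0 cut_test0 i0); rewrite normc_ge0.
Qed.

Lemma cut_dist_positivity M N : cut_dist M N = 0 -> M = N.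
Proof.
move=> /(cut_norm0_ae (integrable_L2B M N)) MN.
have : kernel_fun M = kernel_fun N %[ae nu].
  by apply: filterS MN => z /eqP; rewrite subr_eq0 => /eqP.
case: M N {MN} => [M [[cM]]] [N [[cN]]]; rewrite /kernel_fun /= => MN.
have {}MN : M = N.
  rewrite -[M]reprK -[N]reprK; apply/eqP; rewrite eqmodE.
  exact/asboolP.
by subst N; do 3 f_equal; exact: Prop_irrelevance.
Qed.

Lemma cut_dist_sym M N : cut_dist M N = cut_dist N M.
Proof.
suff le M' N' : cut_dist M' N' <= cut_dist N' M'.
  by apply/eqP; rewrite eq_le !le.
rewrite /cut_dist (_ : (fun z => _) =
    fun z => - (kernel_fun N' z - kernel_fun M' z)).
  exact/cut_normN/integrable_L2B.
by apply/funext => z; rewrite opprB.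
Qed.

Lemma cut_dist_triangle N M P : cut_dist M P <= cut_dist M N + cut_dist N P.
Proof.
rewrite /cut_dist (_ : (fun z => _ - kernel_fun P z) =
    fun z => (kernel_fun M z - kernel_fun N z) + (kernel_fun N z - kernel_fun P z)).
  exact: cut_normD (integrable_L2B _ _) (integrable_L2B _ _).
by apply/funext => z; rewrite addrA subrK.
Qed.

HB.instance Definition _ := isMetric.Build R L2_kernel
  cut_distxx cut_dist_positivity cut_dist_sym cut_dist_triangle.

End cut_norm.

Section sphere.
Context (R : realType).

Definition dot (m : nat) (x y : 'rV[R]_m) : R := \sum_i x 0 i * y 0 i.

(* not the norm `|x| of 'rV[R]_m, which is the sup norm *)
Definition norm2 (m : nat) (x : 'rV[R]_m) : R := Num.sqrt (dot x x).

Definition sphere (n : nat) : Type := {x : 'rV[R]_n.+1 | norm2 x == 1}.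

Context (n : nat).

Lemma sphere_point : norm2 (delta_mx 0 0 : 'rV[R]_n.+1) == 1.
Proof.
rewrite /norm2 /dot (bigD1 ord0)//= big1 => [|i i0]; rewrite !mxE/=.
  by rewrite addr0 mulr1 sqrtr1.
by rewrite (negPf i0) mulr0.
Qed.

HB.instance Definition _ :=
  Choice.copy (sphere n) {x : 'rV[R]_n.+1 | norm2 x == 1}.
HB.instance Definition _ := isPointed.Build (sphere n)
  (exist (fun x : 'rV[R]_n.+1 => norm2 x == 1) _ sphere_point).

Definition sphere_coord (i : 'I_n.+1) (x : sphere n) : R := sval x 0 i.

(* the Borel sigma-algebra: the one generated by the coordinates *)
HB.instance Definition _ := @isMeasurable.Build default_measure_display
  (sphere n) (g_sigma_preimage sphere_coord)
  (@sigma_algebra0 _ _ _) (@sigma_algebraC _ _) (@sigma_algebra_bigcup _ _ _).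

Definition is_rotation (phi : sphere n -> sphere n) : Prop :=
  exists Q : 'M[R]_n.+1, [/\ Q *m Q^T = 1%:M, \det Q = 1 &
    forall x, sval (phi x) = sval x *m Q].

Definition rotation_invariant (mu : probability (sphere n) R) : Prop :=
  forall phi, is_rotation phi ->
  forall A, measurable A -> mu (phi @^-1` A) = mu A.

Definition spherical_kernel (f : R -> R) (z : sphere n * sphere n) : R :=
  f (dot (sval z.1) (sval z.2)).

(* `f` stands for a function [-1, 1] -> R: `x . y` lies in [-1, 1] on the
   sphere, so the values of `f` elsewhere are irrelevant *)
Definition spherical_graphons (mu : probability (sphere n) R) :
    set (L2_kernel mu) :=
  [set W | exists f : R -> R,
    [/\ measurable_fun (`[-1, 1] : set R) f,
        forall t, t \in `[-1, 1] -> 0 <= f t <= 1 &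
        kernel_fun W = spherical_kernel f %[ae (mu \x mu)%E]]].

Lemma measurable_coord i : measurable_fun [set: sphere n] (sphere_coord i).
Proof.
move=> _ Y mY; rewrite setTI; apply: sub_sigma_algebra => /=.
rewrite -bigcup_seq/=; exists i => /=; first by rewrite mem_index_enum.
by exists Y => //; rewrite setTI.
Qed.

Lemma dot_sphere (x : sphere n) : dot (sval x) (sval x) = 1.
Proof.
case: x => x /= /eqP x1; rewrite -[LHS]sqr_sqrtr; last first.
  by apply: sumr_ge0 => i _; rewrite -expr2 sqr_ge0.
by rewrite [Num.sqrt _]x1 expr1n.
Qed.

Lemma dot_itv (x y : sphere n) : dot (sval x) (sval y) \in `[-1, 1].
Proof.
have pos (e : R) : e ^+ 2 = 1 -> 0 <= 1 + e * dot (sval x) (sval y).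
  move=> e1; rewrite -(@pmulrn_lge0 _ _ 2)//.
  rewrite (_ : _ *+ 2 = \sum_i (sval x 0 i + e * sval y 0 i) ^+ 2).
    by apply: sumr_ge0 => i _; rewrite sqr_ge0.
  have -> : \sum_i (sval x 0 i + e * sval y 0 i) ^+ 2 =
      dot (sval x) (sval x) + e ^+ 2 * dot (sval y) (sval y) +
      (e * dot (sval x) (sval y)) *+ 2.
    rewrite /dot !mulr_sumr -sumrMnl -!big_split/=.
    by apply: eq_bigr => i _; ring.
  by rewrite !dot_sphere e1; ring.
have := pos 1 (expr1n _ _); have := pos (-1) (etrans (sqrrN _) (expr1n _ _)).
by rewrite in_itv/=; lra.
Qed.

(* every admissible `f` does define a graphon `S(n, f)` *)
Lemma spherical_graphon_ex (mu : probability (sphere n) R) (f : R -> R) :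
  measurable_fun (`[-1, 1] : set R) f -> (forall t, t \in `[-1, 1] -> 0 <= f t <= 1) ->
  exists W : L2_kernel mu,
    kernel_fun W = spherical_kernel f %[ae (mu \x mu)%E].
Proof.
move=> mf f01.
have mdot : measurable_fun [set: sphere n * sphere n]
    (fun z => dot (sval z.1) (sval z.2)).
  rewrite (_ : (fun _ => _) =
      (fun z => \sum_i (sphere_coord i z.1 * sphere_coord i z.2)))//.
  apply: measurable_sum => i; apply: measurable_funM.
    exact: (measurableT_comp (measurable_coord i) measurable_fst).
  exact: (measurableT_comp (measurable_coord i) measurable_snd).
have mk : measurable_fun [set: sphere n * sphere n] (spherical_kernel f).
  apply: (measurable_comp _ _ mf mdot) => //.
  by move=> _ [z _ <-] /=; exact: dot_itv.
pose g : {mfun (sphere n * sphere n)%type >-> measurableTypeR R} :=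
  HB.pack_for {mfun (sphere n * sphere n)%type >-> measurableTypeR R}
    (spherical_kernel f) (@isMeasurableFun.Build _ _ _ (measurableTypeR R)
    (spherical_kernel f) mk).
pose M : {mfun_ (mu \x mu)%E, (sphere n * sphere n)%type >-> measurableTypeR R} :=
  \pi_({mfun_ (mu \x mu)%E, (sphere n * sphere n)%type >-> measurableTypeR R})%qT g.
have MgE : (repr M : _ -> _) = g %[ae (mu \x mu)%E].
  have : repr M == g %[mod {mfun_ (mu \x mu)%E,
      (sphere n * sphere n)%type >-> measurableTypeR R}]%qT by rewrite reprK.
  by rewrite eqmodE => /asboolP.
have finM : finite_norm (mu \x mu)%E 2%:E M.
  rewrite /finite_norm unlock /Lnorm poweR_lty//.
  apply: (@le_lt_trans _ _ (\int[mu \x mu]_z (cst 1 z))%E).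
    apply: ae_ge0_le_integral => //.
    - by move=> z _; rewrite lee_fin powR_ge0.
    - apply/measurable_EFinP/(measurableT_comp (measurable_powR _)).
      apply: measurableT_comp=> //.
    - apply: filterS MgE => z /(_ I) MgE _.
      rewrite lee_fin /aqEqMfun_to_fun MgE /= powR_mulrn// exprn_ile1//.
      by rewrite ger0_norm; have /andP[] := f01 _ (dot_itv z.1 z.2).
  rewrite integral_cst// mul1e.
  rewrite [ltLHS](_ : _ = 1%E) ?ltry//.
  rewrite -setXTT; transitivity (mu setT * mu setT)%E.
    exact: product_measure1E.
  by rewrite probability_setT mule1.
exists (HB.pack_for (LspaceType2 (mu \x mu)%E) M (@isFinLebesgue.Build _ _ _ _ _ (lee1n 2) M finM)).
exact: MgE.
Qed.

End sphere.

Arguments spherical_graphons {R n} mu _.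

(* Main.v *)
Require Import Defs.
From HB Require Import structures.
From mathcomp Require Import all_boot all_order all_algebra.
From mathcomp Require Import all_classical all_reals all_analysis.
From mathcomp Require Import ess_sup_inf measurable_realfun complex.
From mathcomp Require Import ring lra.

(* Write [S f] for the graphon x, y |-> f (x . y).  For [g] with values in [-1, 1],
   Cauchy-Schwarz bounds the square of the cut norm of [S g] by a multiple of the
   mean over x, y of the modulus of
     h (x, y) = int g (x . z) g (y . z) dmu(z).
   Let (g_k) be a sequence of such functions whose primitives tend to 0 pointwise,
   so that g_k tends to 0 weakly.  Then h_k (x, y) tends to 0 for almost all x, y:
   as n >= 2, one can average over the rotations of z in a plane orthogonal to x,
   which fix x . z, whereas the law of y . z under such a rotation is absolutely
   continuous with respect to Lebesgue measure.  Hence the cut norm of S (f - f')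
   is small, uniformly in f and f', as soon as the primitives of f and f' are
   uniformly close.  Compactness follows: along an ultrafilter of graphons S f the
   primitives of the functions f converge, uniformly since they are 1-Lipschitz,
   to a nondecreasing 1-Lipschitz function, which by the Radon-Nikodym theorem is
   the primitive of a function with values in [0, 1]. *)

Set Implicit Arguments.
Unset Strict Implicit.
Unset Printing Implicit Defensive.
Import Order.TTheory GRing.Theory Num.Theory.
Import numFieldNormedType.Exports.
Import Normc.
Local Open Scope classical_set_scope.
Local Open Scope ring_scope.
Local Open Scope complex_scope.

(** * Weak convergence of bounded functions *)

(** The kernel h, called [gram g] below, belongs to the square of the symmetric operator with kernel
    g (x . y). Passing to this square turns weak convergence into decay, but not on the circle: the
    Chebyshev polynomials T_k tend weakly to 0 on [-1, 1], whereas T_k (x . y) is the cosine of k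
    times the angle between x and y, and testing it with e^(i k x) and e^(i k y) shows that its cut
    norm is at least 1/2. What is missing there is precisely the plane orthogonal to x.

    Every rotation of that plane preserves the measure, so the average may be taken for any law of
    the angle that makes y . z absolutely continuous. A quarter of the circle in its rational
    parametrization is used: differences of coordinates then factor explicitly and no trigonometric
    function occurs.

    The decay obtained in this way has no rate, which is why uniformity in f and f' is derived by
    contradiction, along a sequence of bad functions. *)

Section finite_measure_integral.
Context d (T : measurableType d) (R : realType).
Implicit Type nu : {finite_measure set T -> \bar R}.

Lemma bounded_integrable nu (f : T -> R) (c : R) (D : set T) : measurable D ->
  measurable_fun D f -> (forall x, D x -> `|f x| <= c) ->
  nu.-integrable D (EFin \o f).
Proof.
move=> mD mf fc; apply: measurable_bounded_integrable => //.
  by rewrite ltey_eq fin_num_measure.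
exists c; split; first exact: num_real.
by move=> e ce x Dx /=; rewrite (le_trans (fc _ Dx))// ltW.
Qed.

Lemma le_Rintegral_bounded nu (f : T -> R) (c : R) (D : set T) : measurable D ->
  measurable_fun D f -> (forall x, D x -> `|f x| <= c) ->
  `|Rintegral nu D f| <= c * fine (nu D).
Proof.
move=> mD mf fc; have fi := bounded_integrable nu mD mf fc.
apply: (le_trans (le_normr_Rintegral mD fi)).
rewrite -Rintegral_cst//; apply: le_Rintegral => //.
  exact: (integrable_abse fi).
apply: (@bounded_integrable _ _ `|c|) => // x _.
Qed.

Lemma Rintegral_bounded_cvg0 nu (f : nat -> T -> R) (c : R) :
  (forall n, measurable_fun setT (f n)) -> (forall n x, `|f n x| <= c) ->
  {ae nu, forall x, f n x @[n --> \oo] --> 0} ->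
  Rintegral nu setT (f n) @[n --> \oo] --> 0.
Proof.
move=> mf fc f0.
have mfE n : measurable_fun setT (EFin \o f n) by exact/measurable_EFinP.
have i_c : nu.-integrable setT (EFin \o cst c).
  by apply: (@bounded_integrable _ _ `|c|).
have := @dominated_convergence _ _ _ nu setT measurableT (fun n => EFin \o f n)
  (cst 0%E) (EFin \o cst c) mfE (measurable_cst _) _ i_c.
case.
- apply: filterS f0 => x fx _; apply: cvg_EFin; last exact: fx.
  by apply: nearW.
- by apply: aeW => x n _ /=; rewrite lee_fin.
- move=> _ _; rewrite integral0 => H.
  by have /fine_cvg := H.
Qed.

End finite_measure_integral.

Lemma Rintegral_probability_cst d (T : measurableType d) (R : realType)
  (P : probability T R) (c : R) : Rintegral P setT (cst c) = c.
Proof.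
transitivity (c * fine (P setT)); first exact: Rintegral_cst.
by rewrite probability_setT mulr1.
Qed.

Lemma Rintegral_probability_le1 d (T : measurableType d) (R : realType)
    (P : probability T R) (f : T -> R) : measurable_fun setT f ->
  (forall x, `|f x| <= 1) -> `|Rintegral P setT f| <= 1.
Proof.
move=> mf f1; have -> : 1 = 1 * fine (P setT) by rewrite probability_setT mulr1.
by apply: le_Rintegral_bounded.
Qed.

Section weak_convergence.
Import HBSimple.
Context d (T : measurableType d) (R : realType).
Variables (nu : {finite_measure set T -> \bar R}) (g : nat -> T -> R).
Hypothesis mg : forall n, measurable_fun setT (g n).
Hypothesis g1 : forall n x, `|g n x| <= 1.

Let ig n D : measurable D -> nu.-integrable D (EFin \o g n).
Proof. by move=> mD; apply: (@bounded_integrable _ _ _ _ _ 1) => //; exact: measurable_funTS. Qed.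

Let J n B := Rintegral nu B (g n).

(** The sets on which the integrals tend to 0 form a Dynkin system. The whole space is a separate
    hypothesis because [G] need not contain it, as for the rays used later. *)
Lemma weak_cvg_dynkin (G : set (set T)) :
  @measurable _ T = <<s G >> -> setI_closed G ->
  J n setT @[n --> \oo] --> 0 ->
  (forall B, G B -> J n B @[n --> \oo] --> 0) ->
  forall B, measurable B -> J n B @[n --> \oo] --> 0.
Proof.
move=> GE GI IT IG B; rewrite GE.
apply: (dynkin_induction (P := fun B => J n B @[n --> \oo] --> 0) GE GI IT IG).
- move=> S mS IS.
  have -> : (fun n => J n (~` S)) = (fun n => J n setT - J n S).
    apply/funext => n; rewrite /J -(setUv S) Rintegral_setU//.
    + by rewrite addrAC subrr add0r.
    + exact: measurableC.
    + by apply: ig; rewrite setUv.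
    + exact/disj_setPCl.
  by rewrite -[X in _ --> X](subr0 0); exact: cvgB.
- move=> F mF tF IF.
  pose U N := \big[setU/set0]_(k < N) F k.
  have mU N : measurable (U N) by exact: bigsetU_measurable.
  have mUoo : measurable (\bigcup_k F k) by exact: bigcupT_measurable.
  have UsubT N : U N `<=` \bigcup_k F k by exact: bigsetU_bigcup.
  have IU N : J n (U N) @[n --> \oo] --> 0.
    elim: N => [|N IHN].
      rewrite (_ : (fun n => _) = cst 0); first exact: cvg_cst.
      by apply/funext => n; rewrite /U big_ord0 /J Rintegral_set0.
    have -> : (fun n => J n (U N.+1)) = (fun n => J n (U N) + J n (F N)).
      apply/funext => n; rewrite /U big_ord_recr/= /J Rintegral_setU//.
      + exact: mU.
      + by apply: ig; apply: measurableU => //; exact: mU.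
      + apply/disj_setPS; rewrite -(bigcup_mkord N F) => x [[k/= kN Fk] FN].
        have kE : k = N by apply: tF => //; exists x.
        by rewrite kE ltnn in kN.
    by rewrite -[X in _ --> X](addr0 0); exact: cvgD.
  have tail : fine (nu (\bigcup_k F k)) - fine (nu (U N)) @[N --> \oo] --> 0.
    rewrite -(subrr (fine (nu (\bigcup_k F k)))); apply: cvgB; first exact: cvg_cst.
    apply: fine_cvg; rewrite fineK; last exact: fin_num_measure.
    have := @measure_semi_sigma_additive _ _ _ nu F mF tF mUoo.
    under eq_fun do rewrite big_mkord.
    rewrite [X in X @ _ --> _ -> _](_ : _ = (fun N => nu (U N)))//.
    apply/funext => N; rewrite /U measure_semi_additive_ord//.
      by move=> i j _ _ ij; apply/val_inj; exact: tF.
    exact: mU.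
  (* As [g n] is bounded by 1, the error of a finite union is at most the mass of the tail,
     uniformly in [n]; this permits the exchange of the limits in [n] and [N]. *)
  have tailE n N : `|J n (\bigcup_k F k) - J n (U N)| <=
      fine (nu (\bigcup_k F k)) - fine (nu (U N)).
    have mD : measurable (\bigcup_k F k `\` U N) by exact: measurableD.
    have eqU : \bigcup_k F k = U N `|` (\bigcup_k F k `\` U N).
      by rewrite setDUK.
    have dis : [disjoint U N & (\bigcup_k F k `\` U N)].
      by apply/disj_setPS => x [? []].
    rewrite {1}eqU /J Rintegral_setU//; last by rewrite -eqU; exact: ig.
    rewrite addrAC subrr add0r [in leRHS]eqU measureU//; last by rewrite setDIK.
    rewrite fineD ?fin_num_measure// addrAC subrr add0r -[leRHS]mul1r.
    by apply: le_Rintegral_bounded => //; exact: measurable_funTS.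
  apply/cvgr0Pnorm_le => e e0.
  have /cvgr0Pnorm_le/(_ (e / 2))[|N _ HN] := tail; first by rewrite divr_gt0.
  have /cvgr0Pnorm_le/(_ (e / 2))[|n0 _ Hn] := IU N; first by rewrite divr_gt0.
  exists n0 => // n /= n0n.
  rewrite -(subrK (J n (U N)) (J n _)) (le_trans (ler_normD _ _))//.
  rewrite [leRHS]splitr lerD//; last exact: Hn.
  apply: (le_trans (tailE n N)); apply: le_trans (HN N _); first exact: ler_norm.
  by rewrite /= leqnn.
Qed.

Hypothesis Jcvg : forall B, measurable B -> J n B @[n --> \oo] --> 0.

Let mgM n (h : T -> R) : measurable_fun setT h ->
  measurable_fun setT (fun x => g n x * h x).
Proof. by move=> mh; exact: measurable_funM. Qed.

Let simple_cvg (N : nat) (c : nat -> R) (A : nat -> set T) :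
  (forall i, measurable (A i)) ->
  Rintegral nu setT (fun x => g n x * \sum_(i < N) c i * \1_(A i) x)
    @[n --> \oo] --> 0.
Proof.
move=> mA.
have iA n i : nu.-integrable setT (EFin \o (fun x => \1_(A i) x * g n x)).
  apply: (@bounded_integrable _ _ _ _ _ 1) => //.
    by apply: measurable_funM => //; exact: measurable_indic.
  by move=> x _; rewrite normrM mulr_ile1// indicE ger0_norm ?lern1 ?leq_b1.
have iS n : forall N, nu.-integrable setT
    (EFin \o (fun x => g n x * \sum_(i < N) c i * \1_(A i) x)).
  move=> {}N; elim: N => [|N IHN].
    under eq_fun do rewrite /= big_ord0 mulr0; exact: integrable0.
  rewrite (_ : _ \o _ = (fun x => (g n x * \sum_(i < N) c i * \1_(A i) x)%:E +
     ((c N)%:E * (\1_(A N) x * g n x)%:E))%E).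
    exact: (integrableD measurableT IHN (integrableZl measurableT (c N) (iA n N))).
  apply/funext => x /=; rewrite big_ord_recr/= -EFinM -EFinD; congr EFin.
  by ring.
elim: N => [|N IHN].
  rewrite (_ : (fun n => _) = cst 0); first exact: cvg_cst.
  apply/funext => n; rewrite /Rintegral.
  by under eq_integral do rewrite big_ord0 mulr0; rewrite integral0.
rewrite (_ : (fun n => _) = (fun n =>
    Rintegral nu setT (fun x => g n x * \sum_(i < N) c i * \1_(A i) x) +
    c N * J n (A N))).
  rewrite -[X in _ --> X](addr0 0); apply: cvgD => //.
  by rewrite -[X in _ --> X](mulr0 (c N)); apply: cvgMr; exact: Jcvg.
apply/funext => n.
have -> : J n (A N) = Rintegral nu setT (fun x => \1_(A N) x * g n x).
  rewrite /J Rintegral_mkcond; apply: eq_Rintegral => x _.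
  by rewrite patchE indicE; case: ifPn => _; rewrite ?mul1r ?mul0r.
rewrite -RintegralZl// -RintegralD//; last exact: (integrableZl _ (c N) (iA n N)).
by apply: eq_Rintegral => x _; rewrite big_ord_recr/=; ring.
Qed.

(** Simple functions are dense in L1, and replacing [k] by a simple function costs at most their L1
    distance, whatever [n], since [g n] is bounded by 1. *)
Lemma weak_cvg_integrable (k : T -> R) :
  nu.-integrable setT (EFin \o k) ->
  Rintegral nu setT (fun x => g n x * k x) @[n --> \oo] --> 0.
Proof.
move=> ik; have [s [/= is_ _ ks]] := approximation_sfun_integrable measurableT ik.
have igM n (h : T -> R) : nu.-integrable setT (EFin \o h) ->
    nu.-integrable setT (EFin \o (fun x => g n x * h x)).
  move=> ih; have /measurable_EFinP mh := measurable_int _ ih.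
  apply: le_integrable ih => //; first exact/measurable_EFinP/mgM.
  by move=> x _ /=; rewrite lee_fin normrM ler_piMl.
have iB m : nu.-integrable setT (EFin \o (fun x => k x - s m x)).
  exact: (integrableB measurableT ik (is_ m)).
have S0 m : Rintegral nu setT (fun x => g n x * s m x) @[n --> \oo] --> 0.
  have vE := fimfunEord (s m).
  under eq_fun do under eq_Rintegral do rewrite vE.
  set F := finmap.enum_fset _.
  have mA i : measurable (s m @^-1` [set F`_i]) by exact: measurable_funPTI.
  exact: (@simple_cvg (size F) (fun i => F`_i) _ mA).
apply/cvgr0Pnorm_le => e e0.
have /fine_cvg/cvgr0Pnorm_le/(_ (e / 2)) := ks.
case=> [|m _ /(_ m (leqnn m)) Hm]; first by rewrite divr_gt0.
have /cvgr0Pnorm_le/(_ (e / 2))[|n0 _ Hn] := S0 m; first by rewrite divr_gt0.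
exists n0 => // n /= n0n.
rewrite (_ : Rintegral _ _ _ = Rintegral nu setT (fun x => g n x * (k x - s m x)) +
  Rintegral nu setT (fun x => g n x * s m x)); last first.
  rewrite -RintegralD//; [|exact: igM (iB m)|exact: igM (is_ m)].
  by apply: eq_Rintegral => x _; ring.
rewrite (le_trans (ler_normD _ _))// [leRHS]splitr lerD//; last exact: Hn.
apply: (le_trans (le_normr_Rintegral measurableT (igM _ _ (iB m)))).
apply: le_trans Hm; rewrite ger0_norm; last first.
  by rewrite fine_ge0// integral_ge0.
apply: (@le_trans _ _ (Rintegral nu setT (fun x => `|k x - s m x|))).
  apply: le_Rintegral => //; first exact: (integrable_abse (igM _ _ (iB m))).
    exact: (integrable_abse (iB m)).
  by move=> x _; rewrite normrM ler_piMl.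
by [].
Qed.

(** The density of [kap] with respect to [nu] is integrable, hence an admissible test function. *)
Lemma weak_cvg_dominated (kap : {finite_measure set T -> \bar R}) :
  kap `<< nu -> Rintegral kap setT (g n) @[n --> \oo] --> 0.
Proof.
move=> knu; pose D := Radon_Nikodym (charge_of_finite_measure kap) nu.
have Dfin x : D x \is a fin_num by exact: Radon_Nikodym_fin_num.
have iD : nu.-integrable setT (EFin \o (fine \o D)).
  rewrite (_ : _ \o _ = D); first exact: Radon_Nikodym_integrable.
  by apply/funext => x /=; rewrite fineK.
have := weak_cvg_integrable iD.
rewrite (_ : (fun n => _) = (fun n => Rintegral kap setT (g n)))//.
apply/funext => n; congr fine.
rewrite -(Radon_Nikodym_change_of_variables knu)//.
  by apply: eq_integral => x _ /=; rewrite EFinM fineK.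
exact: (@bounded_integrable _ _ _ _ _ 1).
Qed.

End weak_convergence.

(** * Absolute continuity of the law of a coordinate under a random plane rotation *)

Section null_preimages.
Context (R : realType).
Local Notation leb := (@lebesgue_measure R).

Lemma lebesgue_null_cover (N : set R) (e : R) : leb N = 0%E -> 0 < e ->
  exists2 ab : nat -> R * R, (forall i, (ab i).1 <= (ab i).2) /\
     N `<=` \bigcup_i `](ab i).1, (ab i).2]%classic &
     (\sum_(i <oo) ((ab i).2 - (ab i).1)%:E < e%:E)%E.
Proof.
move=> N0 e0.
have : (leb N < e%:E)%E by rewrite N0 lte_fin.
rewrite /lebesgue_measure /lebesgue_stieltjes_measure /measure_extension /=.
rewrite /mu_ext => /ereal_inf_lt[_ [F [mF NF] <-] Fe].
have /choice[ab abP] i : exists ab : R * R, [/\ ab.1 <= ab.2, F i = `]ab.1, ab.2]%classic &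
    wlength idfun (F i) = (ab.2 - ab.1)%:E].
  have [[a b] _ /= <-] := mF i; have [ab|ba] := leP a b.
    by exists (a, b); split => //=; rewrite wlength_itv_bnd.
  (* A generator with its endpoints in the wrong order is empty; it is rewritten as []a, a]] so that
     all lengths are nonnegative. *)
  exists (a, a); split => //=.
    by rewrite !set_itv_ge// ?bnd_simp ?ltxx// -leNgt ltW.
  by rewrite set_itv_ge ?wlength0 ?subrr// bnd_simp -leNgt ltW.
exists ab.
  split=> [i|]; first by have [] := abP i.
  by move=> t /NF[i _ Fit]; exists i => //; have [_ <-] := abP i.
by move: Fe; congr (_ < _)%E; apply: eq_eseriesr => i _; have [] := abP i.
Qed.

(** On [E] the map [phi] has an [L]-Lipschitz inverse, so the part of [E] sent into an interval of
    length l lies within L l of any of its points. Summing over a cover of [N] of small total length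
    gives the claim. *)
Lemma expansive_preimage_null (phi : R -> R) (E N : set R) (L : R) :
  (forall t u, E t -> E u -> `|t - u| <= L * `|phi t - phi u|) ->
  leb N = 0%E -> measurable (E `&` phi @^-1` N) -> leb (E `&` phi @^-1` N) = 0%E.
Proof.
move=> EL N0 mS; apply/eqP; rewrite eq_le measure_ge0 andbT.
apply/lee_addgt0Pr => e e0; rewrite add0e.
(* The factor 2 is for intervals centred at a point [c i] of the preimage; [|L| + 1] replaces [L] to
   be positive. *)
pose k := 2 * (`|L| + 1).
have k0 : 0 < k by rewrite mulr_gt0// ltr_wpDl.
have [ab [ab12 Nab] sum_e] := lebesgue_null_cover N0 (divr_gt0 e0 k0).
have /choice[c cP] i : exists c : R, E `&` phi @^-1` `](ab i).1, (ab i).2] `<=`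
    `[c - (`|L| + 1) * ((ab i).2 - (ab i).1), c + (`|L| + 1) * ((ab i).2 - (ab i).1)].
  have [->|/set0P[c [Ec]]] := eqVneq (E `&` phi @^-1` `](ab i).1, (ab i).2]) set0.
    by exists 0.
  rewrite /= in_itv/= => /andP[ac cb]; exists c => t [Et]/=.
  rewrite !in_itv/= => /andP[at_ tb]; rewrite -ler_distl.
  apply: (le_trans (EL _ _ Et Ec)).
  apply: (@le_trans _ _ (`|L| * `|phi t - phi c|)); first by rewrite ler_wpM2r// ler_norm.
  apply: ler_pM => //; first by rewrite lerDl.
  by rewrite ler_norml; apply/andP; split; lra.
pose C i := `[c i - (`|L| + 1) * ((ab i).2 - (ab i).1),
              c i + (`|L| + 1) * ((ab i).2 - (ab i).1)]%classic.
have mC i : measurable (C i) by exact: measurable_itv.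
have SC : E `&` phi @^-1` N `<=` \bigcup_i C i.
  by move=> t [Et /Nab [i _ Hi]]; exists i => //; apply: cP.
apply: (le_trans (@measure_sigma_subadditive _ _ _ leb _ _ mC mS SC)).
have Cw i : leb (C i) = (k%:E * ((ab i).2 - (ab i).1)%:E)%E.
  rewrite lebesgue_measure_itv/= lte_fin -EFinM.
  have := ab12 i; rewrite /k; set l := _.2 - _.1 => abi.
  have l0 : 0 <= l by rewrite subr_ge0.
  case: ltP => [_|h]; first by rewrite -EFinB; congr EFin; ring.
  have : (`|L| + 1) * l <= 0 by lra.
  rewrite pmulr_rle0 ?ltr_wpDl// => l0'.
  by rewrite (_ : l = 0) ?mulr0//; apply/eqP; rewrite eq_le l0 l0'.
rewrite (eq_eseriesr (fun i _ => Cw i)).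
rewrite nneseriesZl; last by move=> i _; rewrite lee_fin subr_ge0.
rewrite muleC -lee_pdivlMr// ltW//.
Qed.

(** With t the tangent of half the angle, these are the cosine and the sine of the angle; t in
    [0, 1] describes a quarter of the circle. *)
Definition circle_cos (t : R) : R := (1 - t ^+ 2) / (1 + t ^+ 2).
Definition circle_sin (t : R) : R := 2 * t / (1 + t ^+ 2).

Lemma circle_den_gt0 (t : R) : 0 < 1 + t ^+ 2.
Proof. by rewrite ltr_pwDl// sqr_ge0. Qed.

Lemma measurable_circle_cos : measurable_fun setT circle_cos.
Proof.
apply: continuous_measurable_fun => t; apply: cvgM.
  apply: cvgB; [exact: cvg_cst|exact: exprn_continuous].
apply: cvgV; first by rewrite gt_eqF// circle_den_gt0.
apply: cvgD; [exact: cvg_cst|exact: exprn_continuous].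
Qed.

Lemma measurable_circle_sin : measurable_fun setT circle_sin.
Proof.
apply: continuous_measurable_fun => t; apply: cvgM; first exact: mulrl_continuous.
apply: cvgV; first by rewrite gt_eqF// circle_den_gt0.
apply: cvgD; [exact: cvg_cst|exact: exprn_continuous].
Qed.

Lemma measurable_circle (a p q : R) :
  measurable_fun setT (fun t => a + p * circle_cos t + q * circle_sin t).
Proof.
apply: measurable_funD; [apply: measurable_funD => //|]; apply: measurable_funM => //.
  exact: measurable_circle_cos.
exact: measurable_circle_sin.
Qed.

(** The factor t - u is explicit; on the diagonal the remaining numerator becomes q (1 - t^2) - 2 p
    t, which vanishes exactly at the critical points. *)
Lemma circle_diff (a p q t u : R) :
  (a + p * circle_cos t + q * circle_sin t) - (a + p * circle_cos u + q * circle_sin u) =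
  2 * (t - u) * (q * (1 - t * u) - p * (t + u)) / ((1 + t ^+ 2) * (1 + u ^+ 2)).
Proof.
have := lt0r_neq0 (circle_den_gt0 t); have := lt0r_neq0 (circle_den_gt0 u).
by move=> u0 t0; rewrite /circle_cos /circle_sin; field; rewrite t0 u0.
Qed.

(** If q is nonzero, the two roots of this quadratic have product -1, so at most one is nonnegative;
    if q = 0, the only root is 0. *)
Lemma circle_critical (p q t u : R) : (p, q) != (0, 0) -> 0 <= t -> 0 <= u ->
  q * (1 - t ^+ 2) - 2 * p * t = 0 -> q * (1 - u ^+ 2) - 2 * p * u = 0 -> t = u.
Proof.
move=> pq0 t0 u0 Dt Du; apply/eqP; rewrite -subr_eq0; apply: contraNT pq0 => tu.
have h1 : q * (t + u) + 2 * p = 0.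
  by apply: (mulfI tu); rewrite mulr0; lra.
have q0 : q = 0.
  have tu1 : 1 + t * u != 0 by rewrite gt_eqF// ltr_pwDl// mulr_ge0.
  apply: (mulIf tu1); rewrite mul0r.
  have : (q * (t + u) + 2 * p) * t = 0 by rewrite h1 mul0r.
  by lra.
by move: h1; rewrite q0 mul0r add0r => /eqP; rewrite mulf_eq0 pnatr_eq0/= => /eqP ->.
Qed.

(** Outside the single critical point, [0, 1] is a countable union of short intervals on which the
    map is expansive, and [expansive_preimage_null] applies to each of them. *)
Lemma circle_preimage_null (a p q : R) (N : set R) : (p, q) != (0, 0) ->
  measurable N -> leb N = 0%E ->
  leb (`[0, 1] `&` (fun t => a + p * circle_cos t + q * circle_sin t) @^-1` N) = 0%E.
Proof.
move=> pq0 mN N0; pose psi t := a + p * circle_cos t + q * circle_sin t; rewrite -/psi.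
have mpsi : measurable_fun setT psi by exact: measurable_circle.
have mpN : measurable (psi @^-1` N) by rewrite -[X in measurable X]setTI; exact: mpsi.
pose D t := q * (1 - t ^+ 2) - 2 * p * t.
pose I k j : set R := `[0, 1]%classic `&` `[j%:R / k.+1%:R, j.+1%:R / k.+1%:R]%classic.
have mI k j : measurable (I k j) by exact: measurableI.
(* The same [k] governs the length of the pieces and the expansion constant, so that countably many
   pairs [(k, j)] suffice. *)
pose good k j := forall t u, I k j t -> I k j u -> `|t - u| <= k.+1%:R * `|psi t - psi u|.
pose B k j := if `[< good k j >] then I k j `&` psi @^-1` N else set0.
pose Z : set R := `[0, 1]%classic `&` [set t | D t = 0].
have Z0 : leb.-negligible Z.
  have [->|/set0P[z [z01 Dz]]] := eqVneq Z set0; first exact: negligible_set0.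
  apply: (@negligibleS _ _ _ leb [set z]).
    move=> t [t01 Dt] /=; apply: circle_critical Dt Dz => //.
    - by move: t01; rewrite /= in_itv/= => /andP[].
    - by move: z01; rewrite /= in_itv/= => /andP[].
  by exists [set z]; split => //; exact: lebesgue_measure_set1.
have B0 k j : leb.-negligible (B k j).
  rewrite /B; case: asboolP => [g|_]; last exact: negligible_set0.
  exists (I k j `&` psi @^-1` N); split => //.
    exact: (measurableI _ _ (mI k j) mpN).
  exact: (expansive_preimage_null g N0 (measurableI _ _ (mI k j) mpN)).
have mT : measurable (`[0, 1] `&` psi @^-1` N) by exact: measurableI.
suff sub (t : R) : `[0, 1]%classic t -> N (psi t) -> (Z `|` \bigcup_k \bigcup_j B k j) t.
  apply/negligibleP => //.
  apply: (@negligibleS _ _ _ leb (Z `|` \bigcup_k \bigcup_j B k j)).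
    by move=> t [t01 Nt]; exact: sub.
  by apply: negligibleU => //; apply: negligible_bigcup => k; exact: negligible_bigcup.
move=> t01 Nt; have [Dt|Dt] := eqVneq (D t) 0; first by left.
right.
have d0 : 0 < `|D t| by rewrite normr_gt0.
set M := `|p| + `|q|.
(* The term 4 M keeps the slope factor [b] on the piece within [|D t| / 2] of [D t]; the term 4
   absorbs the denominator (1 + u^2) (1 + v^2), which is at most 4. *)
have [k kM] : exists k : nat, 4 * (1 + M) <= k.+1%:R * `|D t|.
  exists (Num.truncn (4 * (1 + M) / `|D t|)).
  by rewrite -ler_pdivrMr// ltW// truncnS_gt.
have k0 : 0 < k.+1%:R :> R by rewrite ltr0n.
exists k => //; move: (t01); rewrite /= in_itv/= => /andP[t0 t1].
have Itr : I k (Num.truncn (t * k.+1%:R)) t.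
  split => //=; rewrite in_itv/= ler_pdivrMr// ler_pdivlMr//.
  rewrite truncn_le ?mulr_ge0//=.
  by rewrite ltW// truncnS_gt.
exists (Num.truncn (t * k.+1%:R)) => //.
move: Itr; set j := Num.truncn _ => Itr.
rewrite /B asboolT; first by split.
have near v : I k j v -> 0 <= v <= 1 /\ `|v - t| <= k.+1%:R^-1.
  move: Itr => [_ +] [+ +]; rewrite /= !in_itv/= => /andP[jt tj] -> /andP[jv vj].
  split => //; rewrite -natr1 mulrDl mul1r in tj vj.
  move: (j%:R / _) jt jv tj vj => x jt jv tj vj; move: (_^-1) tj vj => y tj vj.
  by rewrite ler_norml; apply/andP; split; lra.
move=> u v /near[/andP[u0 u1] ut] /near[/andP[v0 v1] vt].
have kk : k.+1%:R * k.+1%:R^-1 = 1 :> R by rewrite divff// gt_eqF.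
set w := k.+1%:R in k0 kM ut vt kk *; set w' := w^-1 in ut vt kk *.
have w'0 : 0 < w' by rewrite invr_gt0.
have M0 : 0 <= M by rewrite addr_ge0.
set b := q * (1 - u * v) - p * (u + v).
have bD : `|b - D t| <= 2 * M * w'.
  have -> : b - D t = - (q * (u * (v - t) + t * (u - t))) - p * ((u - t) + (v - t)).
    by rewrite /b /D; ring.
  apply: (le_trans (ler_normB _ _)); rewrite normrN !normrM.
  have h1 : `|u * (v - t) + t * (u - t)| <= 2 * w'.
    apply: (le_trans (ler_normD _ _)); rewrite !normrM (ger0_norm u0) (ger0_norm t0).
    by rewrite mulr_natl mulr2n lerD// -[leRHS]mul1r ler_pM.
  have h2 : `|u - t + (v - t)| <= 2 * w'.
    by apply: (le_trans (ler_normD _ _)); rewrite mulr_natl mulr2n lerD.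
  have := ler_wpM2l (normr_ge0 q) h1; have := ler_wpM2l (normr_ge0 p) h2.
  by rewrite /M; lra.
have wM : 2 * M * w' <= `|D t| / 2.
  have : w' * (4 * (1 + M)) <= w' * (w * `|D t|) by rewrite ler_wpM2l// ltW.
  by rewrite [leRHS]mulrA (mulrC w' w) kk mul1r; lra.
have bge : `|D t| / 2 <= `|b|.
  have : `|D t| <= `|b| + `|b - D t|.
    by rewrite -{1}(subKr b (D t)) (le_trans (ler_normB _ _)).
  by lra.
rewrite /psi circle_diff -/b !normrM normfV.
have den0 : 0 < (1 + u ^+ 2) * (1 + v ^+ 2) by rewrite mulr_gt0// circle_den_gt0.
rewrite (gtr0_norm den0) (@gtr0_norm _ 2)// mulrA ler_pdivlMr//.
have den4 : (1 + u ^+ 2) * (1 + v ^+ 2) <= 4.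
  have -> : 4 = 2 * 2 :> R by ring.
  by apply: ler_pM; rewrite ?addr_ge0 ?sqr_ge0//; rewrite -[2]/(1 + 1) lerD2l exprn_ile1.
have hw : 4 <= w * (2 * `|b|).
  have : w * `|D t| <= w * (2 * `|b|) by rewrite ler_pM2l//; lra.
  by lra.
apply: (@le_trans _ _ (`|u - v| * (w * (2 * `|b|)))).
  by rewrite ler_wpM2l// (le_trans den4).
by rewrite le_eqVlt; apply/orP; left; apply/eqP; ring.
Qed.

End null_preimages.

(** * Transport of weak convergence along a map *)

Lemma weak_cvg_pushforward d d' (X : measurableType d) (Y : measurableType d')
    (R : realType) (nu : {finite_measure set Y -> \bar R})
    (mu : {finite_measure set X -> \bar R}) (g : nat -> Y -> R) (phi : X -> Y) :
  (forall n, measurable_fun setT (g n)) -> (forall n y, `|g n y| <= 1) ->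
  (forall B, measurable B -> Rintegral nu B (g n) @[n --> \oo] --> 0) ->
  measurable_fun setT phi ->
  (forall N, measurable N -> nu N = 0%E -> mu (phi @^-1` N) = 0%E) ->
  Rintegral mu setT (fun x => g n (phi x)) @[n --> \oo] --> 0.
Proof.
move=> mg g1 gB mphi null.
have [kap0 kap0E] : exists k : {measure set Y -> \bar R}, forall A, k A = mu (phi @^-1` A).
  by unshelve eexists (pushforward mu phi).
have fin : (kap0 setT < +oo)%E by rewrite kap0E preimage_setT ltey_eq fin_num_measure.
(* Restricting to the whole space changes no value; it only packages the image measure as a finite
   one. *)
pose kap : {finite_measure set Y -> \bar R} := mfrestr measurableT fin.
have kapE A : kap A = mu (phi @^-1` A) by rewrite -kap0E -[in RHS](setIT A).
have dom : kap `<< nu.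
  by apply/null_content_dominatesP => N mN N0; rewrite kapE; exact: null.
have := weak_cvg_dominated mg g1 gB dom.
rewrite [X in X @ _ --> _ -> _](_ : _ = fun n => Rintegral mu setT (fun x => g n (phi x)))//.
apply/funext => n; congr fine.
have mgn : measurable_fun setT (EFin \o g n) by exact/measurable_EFinP.
have ig : mu.-integrable (phi @^-1` setT) ((EFin \o g n) \o phi).
  rewrite preimage_setT; apply: (@bounded_integrable _ _ _ _ _ 1) => //.
  exact: measurableT_comp.
rewrite -(integral_pushforward mphi mgn ig measurableT).
by apply: eq_measure_integral => A mA _; exact: kapE.
Qed.

Section segment_measure.
Context (R : realType).
Local Notation leb := (@lebesgue_measure R).

Lemma lebesgue_segment_lty (a b : R) : (leb `[a, b] < +oo)%E.
Proof. by rewrite lebesgue_measure_itv/=; case: ifP => _; rewrite -?EFinB ltry. Qed.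

(** A finite measure on the whole line rather than on a subtype: functions on [-1, 1] can then be
    handled as functions on [R]. *)
Definition segment_measure (a b : R) : {finite_measure set (measurableTypeR R) -> \bar R} :=
  @mfrestr _ (measurableTypeR R) R _ leb (measurable_itv `[a, b]) (lebesgue_segment_lty a b).

Lemma segment_measureE (a b : R) A : segment_measure a b A = leb (A `&` `[a, b]).
Proof. by []. Qed.

(** Convergence of the primitives is convergence on the open left rays, which are stable under
    intersection and generate the Borel sets; the rest is transport along the circle map. *)
Lemma circle_weak_cvg (g : nat -> R -> R) (a p q : R) :
  (p, q) != (0, 0) ->
  (forall t, a + p * circle_cos t + q * circle_sin t \in `[-1, 1]) ->
  (forall n, measurable_fun setT (g n)) -> (forall n y, `|g n y| <= 1) ->
  (forall x, Rintegral (segment_measure (-1) 1) `]-oo, x[ (g n) @[n --> \oo] --> 0) ->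
  Rintegral (segment_measure 0 1) setT
    (fun t => g n (a + p * circle_cos t + q * circle_sin t)) @[n --> \oo] --> 0.
Proof.
move=> pq0 psi_itv mg0 g1 g0.
have mg n : measurable_fun (setT : set (measurableTypeR R)) (g n) := mg0 n.
apply: (@weak_cvg_pushforward _ _ _ _ _ (segment_measure (-1) 1)
  (segment_measure 0 1) g _ mg g1) => [|//|N mN].
- apply: (@weak_cvg_dynkin _ (measurableTypeR R) R (segment_measure (-1) 1) g mg g1 _
    (RGenInftyO.measurableE R)).
  + move=> _ _ [x ->] [y ->]; exists (Num.min x y).
    by apply/seteqP; split => z /=; rewrite !in_itv/= lt_min => /andP.
  (* Any bound above 1 would serve as well as 2: the measure lives on [-1, 1], so this ray has full
     mass. *)
  + rewrite [X in X @ _ --> _](_ : _ = fun n => Rintegral (segment_measure (-1) 1) `]-oo, 2[ (g n))//.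
    apply/funext => n; rewrite [RHS]Rintegral_mkcond /Rintegral; congr fine.
    apply: ae_eq_integral => //.
    * by apply/measurable_EFinP; exact: mg.
    * apply/measurable_EFinP/(measurable_restrict _ _ _).1 => //.
      exact: measurable_funTS (mg n).
    * exists (~` `]-oo, 2[%classic); split.
      - exact: measurableC.
      - transitivity (leb (~` `]-oo, 2[ `&` `[-1, 1])) => //.
        rewrite (_ : _ `&` _ = set0) ?measure0//.
        by apply/seteqP; split => x //=; rewrite !in_itv/= => -[/negP]; rewrite -leNgt; lra.
      - by apply: subsetC => x x2 _; rewrite patchE mem_set.
  + by move=> _ [x ->]; exact: g0.
- exact: measurable_circle.
(* Only the part of [N] in [-1, 1] is known to be null, but by [psi_itv] the map takes no value
   outside that interval. *)
- rewrite !segment_measureE => N0; rewrite setIC.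
  have mND : measurable (N `&` `[-1, 1]%classic).
    by apply: measurableI => //; exact: measurable_itv.
  have <- := circle_preimage_null a pq0 mND N0.
  congr (leb _); apply/seteqP; split => t /= [t01 Nt]; split => //.
  by have [] := Nt.
Qed.

End segment_measure.

(** * Rotations *)

Section dot_product.
Context (R : realType).

Lemma dotE m (x y : 'rV[R]_m) : dot x y = (x *m y^T) 0 0.
Proof. by rewrite /dot !mxE; apply: eq_bigr => i _; rewrite !mxE. Qed.

Lemma dotC m (x y : 'rV[R]_m) : dot x y = dot y x.
Proof. by apply: eq_bigr => i _; rewrite mulrC. Qed.

Lemma dotDr m (x y z : 'rV[R]_m) : dot x (y + z) = dot x y + dot x z.
Proof. by rewrite /dot -big_split/=; apply: eq_bigr => i _; rewrite mxE mulrDr. Qed.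

Lemma dotZr m (x y : 'rV[R]_m) c : dot x (c *: y) = c * dot x y.
Proof. by rewrite /dot mulr_sumr; apply: eq_bigr => i _; rewrite mxE mulrCA. Qed.

Lemma dot_mul_delta m (x z : 'rV[R]_m) i j :
  dot x (z *m delta_mx i j) = x 0 j * z 0 i.
Proof.
rewrite /dot (bigD1 j)//= big1 => [|k kj]; rewrite !mxE.
  rewrite addr0; congr (_ * _); rewrite (bigD1 i)//= big1 => [|l li].
    by rewrite mxE !eqxx mulr1 addr0.
  by rewrite mxE (negPf li) mulr0.
rewrite big1 ?mulr0// => l _; rewrite mxE (negPf kj) andbF mulr0//.
Qed.

Lemma dot_delta m (x : 'rV[R]_m) i : dot (delta_mx 0 i) x = x 0 i.
Proof.
rewrite /dot (bigD1 i)//= big1 => [|k ki]; rewrite mxE !eqxx ?mul1r ?addr0//.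
by rewrite (negPf ki) mul0r.
Qed.

Lemma dot_eq0 m (x : 'rV[R]_m) : dot x x = 0 -> x = 0.
Proof.
move=> /eqP; rewrite psumr_eq0 => [/allP h|i _]; last by rewrite -expr2 sqr_ge0.
apply/rowP => i; rewrite mxE; apply/eqP.
by have := h i (mem_index_enum _); rewrite mulf_eq0 orbb.
Qed.

Lemma dot_orthogonal m (x y : 'rV[R]_m) (Q : 'M[R]_m) : Q *m Q^T = 1%:M ->
  dot (x *m Q) (y *m Q) = dot x y.
Proof. by move=> QQ; rewrite !dotE trmx_mul mulmxA -(mulmxA x) QQ mulmx1. Qed.

(* The Householder reflection in the bisecting hyperplane of [x] and [e]. *)
Lemma orthogonal_transitive m (e x : 'rV[R]_m) : dot e e = 1 -> dot x x = 1 ->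
  exists2 Q : 'M[R]_m, Q *m Q^T = 1%:M & e *m Q = x.
Proof.
move=> e1 x1; have [->|xe] := eqVneq x e.
  by exists 1%:M; rewrite ?trmx1 mulmx1.
have [u uE] : exists u, u = x - e by exists (x - e).
have uu : dot u u = 2 * (1 - dot e x).
  rewrite uE -scaleN1r !(dotDr, dotZr) (dotC _ x) (dotC _ e) !(dotDr, dotZr).
  by rewrite x1 e1 (dotC x e); ring.
have uu0 : dot u u != 0.
  by apply: contra xe => /eqP/dot_eq0/eqP; rewrite uE subr_eq0.
pose c := 2 / dot u u.
pose H : 'M[R]_m := 1%:M - c *: (u^T *m u).
have HT : H^T = H by rewrite /H linearB/= linearZ/= trmx_mul trmxK trmx1.
have uuT : u *m u^T = (dot u u)%:M by rewrite [LHS]mx11_scalar -dotE.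
exists H.
  rewrite HT /H mulmxBl mul1mx mulmxBr mulmx1 -scalemxAl -scalemxAr mulmxA.
  rewrite -(mulmxA u^T u) uuT mul_mx_scalar -scalemxAl !scalerA.
  have cc : c * (c * dot u u) = c + c by rewrite /c divfK// mulr_natr mulr2n.
  rewrite cc scalerDl.
  by move: (c *: _) => B; apply/matrixP => i j; rewrite !mxE; ring.
rewrite /H mulmxBr mulmx1 -scalemxAr mulmxA [e *m u^T]mx11_scalar -dotE.
rewrite mul_scalar_mx scalerA.
have -> : c * dot e u = -1.
  have eu : dot e u = dot e x - 1 by rewrite uE -scaleN1r dotDr dotZr e1 mulN1r.
  by apply: (mulIf uu0); rewrite /c mulrAC divfK// eu uu; ring.
by rewrite scaleN1r opprK uE addrC subrK.
Qed.

Lemma det_orthogonal m (Q : 'M[R]_m) : Q *m Q^T = 1%:M -> \det Q = 1 \/ \det Q = -1.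
Proof.
move=> QQ; have : \det Q ^+ 2 == 1 by rewrite expr2 -{2}det_tr -det_mulmx QQ det1.
by rewrite sqrf_eq1 => /orP[/eqP|/eqP]; [left|right].
Qed.

(** If the orthogonal matrix found has determinant -1, it is preceded by the reflection that changes
    the sign of coordinate 1, which fixes the first basis vector. *)
Lemma rotation_transitive m (x : 'rV[R]_m.+2) : dot x x = 1 ->
  exists Q : 'M[R]_m.+2, [/\ Q *m Q^T = 1%:M, \det Q = 1 & delta_mx 0 0 *m Q = x].
Proof.
move=> x1.
have [|Q QQ Qx] := orthogonal_transitive _ x1 (e := delta_mx 0 0).
  by rewrite dot_delta mxE.
have [dQ|dQ] := det_orthogonal QQ; first by exists Q.
pose d : 'rV[R]_m.+2 := \row_j (if j == 1 then -1 else 1).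
exists (diag_mx d *m Q); split.
- rewrite trmx_mul tr_diag_mx mulmxA -(mulmxA _ Q) QQ mulmx1 mulmx_diag.
  apply/matrixP => i j; rewrite !mxE.
  by case: eqP => _; rewrite ?mulrNN mulr1.
- rewrite det_mulmx dQ det_diag (bigD1 1)//= big1 => [|j j1]; rewrite mxE ?eqxx.
    by rewrite mulr1 mulrNN mulr1.
  by rewrite (negPf j1).
- rewrite mulmxA (_ : delta_mx 0 0 *m diag_mx d = delta_mx 0 0)//.
  apply/rowP => j; rewrite mul_mx_diag !mxE eqxx/=.
  by case: eqP => [->|_]; rewrite ?mulr1 ?mul0r.
Qed.

Section plane_rotation.
Context (m : nat) (i1 i2 : 'I_m) (i12 : i1 != i2).

Let P : 'M[R]_m := delta_mx i1 i1 + delta_mx i2 i2.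
Let J : 'M[R]_m := delta_mx i1 i2 - delta_mx i2 i1.

(** [P] projects onto the coordinate plane and [J] is its quarter turn. Since P J = J P = J and J J
    = - P, such matrices multiply like the complex numbers c + i s. *)
Definition plane_rotation (c s : R) : 'M[R]_m := 1%:M + (c - 1) *: P + s *: J.

Lemma plane_rotationM c s c' s' : plane_rotation c s *m plane_rotation c' s' =
  plane_rotation (c * c' - s * s') (c * s' + s * c').
Proof.
have i21 : (i2 == i1) = false by rewrite eq_sym (negPf i12).
have PP : P *m P = P.
  by rewrite /P mulmxDl !mulmxDr
    !mul_delta_mx_cond !eqxx (negPf i12) i21 !mulr0n !mulr1n addr0 add0r.
have PJ : P *m J = J.
  by rewrite /P /J mulmxDl !mulmxBr
    !mul_delta_mx_cond !eqxx (negPf i12) i21 !mulr0n !mulr1n subr0 sub0r.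
have JP : J *m P = J.
  by rewrite /P /J mulmxBl !mulmxDr
    !mul_delta_mx_cond !eqxx (negPf i12) i21 !mulr0n !mulr1n addr0 add0r.
have JJ : J *m J = - P.
  by rewrite /P /J mulmxBl !mulmxBr
    !mul_delta_mx_cond !eqxx (negPf i12) i21 !mulr0n !mulr1n subr0 sub0r opprD.
rewrite /plane_rotation !(mulmxDl, mulmxDr, mul1mx, mulmx1) -!scalemxAl -!scalemxAr.
rewrite PP PJ JP JJ; move: P J => A B.
by apply/matrixP => i j; rewrite !mxE; ring.
Qed.

Lemma tr_plane_rotation c s : (plane_rotation c s)^T = plane_rotation c (- s).
Proof.
apply/matrixP => i j; rewrite /plane_rotation /P /J !mxE (eq_sym j i).
by rewrite !(andbC (j == _)); ring.
Qed.

Lemma plane_rotation_orthogonal c s : c ^+ 2 + s ^+ 2 = 1 ->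
  plane_rotation c s *m (plane_rotation c s)^T = 1%:M.
Proof.
move=> cs; rewrite tr_plane_rotation plane_rotationM mulrN opprK -!expr2 cs.
by rewrite mulrN mulrC addNr /plane_rotation subrr !scale0r !addr0.
Qed.

Lemma dot_plane_rotation (x z : 'rV[R]_m) c s : dot x (z *m plane_rotation c s) =
  (dot x z - (x 0 i1 * z 0 i1 + x 0 i2 * z 0 i2)) +
  (x 0 i1 * z 0 i1 + x 0 i2 * z 0 i2) * c + (x 0 i2 * z 0 i1 - x 0 i1 * z 0 i2) * s.
Proof.
rewrite /plane_rotation /P /J !mulmxDr mulmx1 -!scalemxAr !mulmxDr mulmxN
  -[- (z *m _)]scaleN1r.
by rewrite !(dotDr, dotZr) !dot_mul_delta; ring.
Qed.

(* The rotation is the square of the rotation by half the angle, whence its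
   determinant is 1. *)
Lemma det_circle_rotation t : \det (plane_rotation (circle_cos t) (circle_sin t)) = 1.
Proof.
pose d := (Num.sqrt (1 + t ^+ 2))^-1.
have t0 := circle_den_gt0 t.
have d2 : d ^+ 2 = (1 + t ^+ 2)^-1 by rewrite exprVn sqr_sqrtr// ltW.
have -> : plane_rotation (circle_cos t) (circle_sin t) =
    plane_rotation d (d * t) *m plane_rotation d (d * t).
  by rewrite plane_rotationM /circle_cos /circle_sin -d2; congr plane_rotation; ring.
have : plane_rotation d (d * t) *m (plane_rotation d (d * t))^T = 1%:M.
  apply: plane_rotation_orthogonal; rewrite exprMn d2 -[X in X + _]mulr1 -mulrDr.
  by rewrite mulVf// gt_eqF.
by move=> /det_orthogonal; rewrite det_mulmx => -[] ->; rewrite ?mulrNN mulr1.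
Qed.

Lemma circle_cos2D_sin2 (t : R) : circle_cos t ^+ 2 + circle_sin t ^+ 2 = 1.
Proof.
by rewrite /circle_cos /circle_sin; field; rewrite gt_eqF// circle_den_gt0.
Qed.

End plane_rotation.
End dot_product.

(** * Rotation invariant measures on the sphere *)

Section sphere_measure.
Context (R : realType) (n : nat).
Local Notation S := (sphere R n).

Lemma measurable_dot_sphere d (T : measurableType d) (f : T -> S) (v : T -> 'rV[R]_n.+1) :
  measurable_fun setT f -> (forall i, measurable_fun setT (fun x => v x 0 i)) ->
  measurable_fun setT (fun x => dot (v x) (sval (f x))).
Proof.
move=> mf mv; apply: measurable_sum => i; apply: measurable_funM => //.
exact: (measurableT_comp (measurable_coord i) mf).
Qed.

Lemma measurable_dot_prod : measurable_fun [set: S * S]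
  (fun z => dot (sval z.1) (sval z.2)).
Proof.
apply: measurable_dot_sphere; first exact: measurable_snd.
by move=> i; exact: (measurableT_comp (measurable_coord i) measurable_fst).
Qed.

Lemma measurable_dotr (v : 'rV[R]_n.+1) : measurable_fun [set: S] (fun x => dot v (sval x)).
Proof. by apply: measurable_dot_sphere => //; exact: measurable_id. Qed.

Lemma norm2_eq1 m (x : 'rV[R]_m) : dot x x = 1 -> norm2 x == 1.
Proof. by rewrite /norm2 => ->; rewrite sqrtr1. Qed.

Lemma norm2_orthogonal (Q : 'M[R]_n.+1) (x : S) : Q *m Q^T = 1%:M ->
  norm2 (sval x *m Q) == 1.
Proof. by move=> QQ; apply: norm2_eq1; rewrite dot_orthogonal// dot_sphere. Qed.

Definition rotate (Q : 'M[R]_n.+1) (QQ : Q *m Q^T = 1%:M) (x : S) : S :=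
  exist (fun x : 'rV[R]_n.+1 => norm2 x == 1) _ (norm2_orthogonal x QQ).

Lemma measurable_rotate Q (QQ : Q *m Q^T = 1%:M) : measurable_fun setT (rotate QQ).
Proof.
apply: (@measurability _ _ S S _ _ (\big[setU/set0]_(i < n.+1)
  preimage_set_system setT (@sphere_coord R n i) measurable)) => //.
move=> _ [B + <-]; rewrite -bigcup_seq => -[i _ [Y mY <-]].
rewrite !setTI -comp_preimage.
have : measurable_fun [set: S] (sphere_coord i \o rotate QQ).
  rewrite (_ : _ \o _ = fun x => \sum_k sphere_coord k x * Q k i).
    apply: measurable_sum => k; apply: measurable_funM => //; exact: measurable_coord.
  by apply/funext => x; rewrite /= /sphere_coord /= mxE.
by move=> /(_ measurableT Y mY); rewrite setTI.
Qed.

Section rotation_invariance.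
Variable mu : probability S R.
Hypothesis inv : rotation_invariant mu.

Lemma mu_rotate Q (QQ : Q *m Q^T = 1%:M) (A : set S) : \det Q = 1 -> measurable A ->
  mu (rotate QQ @^-1` A) = mu A.
Proof. by move=> dQ mA; apply: inv => //; exists Q. Qed.

Lemma Rintegral_rotate Q (QQ : Q *m Q^T = 1%:M) (F : S -> R) (c : R) : \det Q = 1 ->
  measurable_fun setT F -> (forall x, `|F x| <= c) ->
  Rintegral mu setT (fun x => F (rotate QQ x)) = Rintegral mu setT F.
Proof.
move=> dQ mF Fc; congr fine.
have mr := measurable_rotate QQ.
have mF' : measurable_fun setT (EFin \o F) by exact/measurable_EFinP.
have iF : mu.-integrable (rotate QQ @^-1` setT) ((EFin \o F) \o rotate QQ).
  rewrite preimage_setT; apply: (@bounded_integrable _ _ _ _ _ c) => //.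
  exact: measurableT_comp.
rewrite -(integral_pushforward mr mF' iF measurableT).
by apply: eq_measure_integral => A mA _; exact: mu_rotate.
Qed.

End rotation_invariance.
End sphere_measure.

(** * Hyperplane sections of the sphere are null *)

Section hyperplanes.
Context (R : realType) (n : nat).
Local Notation S := (sphere R n.+1).
Variable mu : probability S R.
Hypothesis inv : rotation_invariant mu.

Let H (v : 'rV[R]_n.+2) : set S := [set y | dot v (sval y) = 0].

Let mH v : measurable (H v).
Proof.
have -> : H v = (fun y => dot v (sval y)) @^-1` [set 0] by [].
by rewrite -[_ @^-1` _]setTI; exact: measurable_dotr.
Qed.

Let mu_H v : dot v v != 0 -> mu (H v) = mu (H (delta_mx 0 0)).
Proof.
move=> v0; have vv : 0 < dot v v.
  by rewrite lt_neqAle eq_sym v0 sumr_ge0// => i _; rewrite -expr2 sqr_ge0.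
pose c := (Num.sqrt (dot v v))^-1.
have c0 : c != 0 by rewrite invr_eq0 gt_eqF// sqrtr_gt0.
have [|Q [QQ dQ Qe]] := @rotation_transitive R n (c *: v).
  rewrite dotZr dotC dotZr mulrA -expr2 /c exprVn sqr_sqrtr ?ltW//.
  by rewrite mulVf.
rewrite -(mu_rotate inv QQ dQ (mH v)); congr (mu _).
apply/seteqP; split => y; rewrite /H /= => h.
  rewrite -(dot_orthogonal _ _ QQ) Qe dotC dotZr dotC h mulr0//.
move: h; rewrite -(dot_orthogonal _ _ QQ) Qe dotC dotZr dotC => /eqP.
by rewrite mulf_eq0 (negPf c0)/= => /eqP.
Qed.

Let moment (t : nat) : 'rV[R]_n.+2 := \row_i t%:R ^+ i.

(** The product of [y] with [moment t] is the value at t of the polynomial with coefficients [y]. It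
    is nonzero, as [y] is a unit vector, and has degree at most n + 1. *)
Let moment_count (N : nat) (y : S) :
  \sum_(t < N) (\1_(H (moment t)) y : R) <= n.+1%:R.
Proof.
pose p := rVpoly (sval y).
have p0 : p != 0.
  apply/eqP => p0; have := dot_sphere y.
  rewrite -[sval y]rVpolyK -/p p0 linear0 /dot big1 => [/esym/eqP|i _].
    by rewrite oner_eq0.
  by rewrite mxE mul0r.
pose s := [seq t%:R : R | t <- iota 0 N & `[< H (moment t) y >]].
have : (size s < size p)%N.
  apply: max_poly_roots => //.
    apply/allP => r; rewrite /s => /mapP[t].
    rewrite mem_filter => /andP[/asboolP Ht _] ->.
    rewrite /root /p /rVpoly horner_poly; apply/eqP; rewrite -[RHS]Ht.
    by apply: eq_bigr => i _; rewrite valK mxE mulrC.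
  rewrite map_inj_uniq; first by rewrite filter_uniq// iota_uniq.
  by move=> i j /eqP; rewrite eqr_nat => /eqP.
move=> /leq_trans/(_ (size_poly _ _)); rewrite size_map size_filter ltnS => sn.
apply: (@le_trans _ _ (count (fun t => `[< H (moment t) y >]) (iota 0 N))%:R).
  rewrite -sum1_count natr_sum [leRHS]big_mkcond/= -[N in iota 0 N]subn0.
  rewrite big_mkord; apply: ler_sum => t _.
  by rewrite indicE; case: asboolP => h; [rewrite mem_set|rewrite memNset].
by rewrite ler_nat.
Qed.

(* Infinitely many hyperplanes, orthogonal to points of the moment curve, have
   the same measure, while a point lies on at most [n + 1] of them. *)
Lemma hyperplane_null v : dot v v != 0 -> mu (H v) = 0%E.
Proof.
move=> v0; rewrite mu_H//; set q := mu _.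
have qE (t : nat) : mu (H (moment t)) = q.
  apply: mu_H; rewrite gt_eqF// (@lt_le_trans _ _ 1)//.
  rewrite /dot (bigD1 ord0)//= mxE expr0 mulr1 lerDl sumr_ge0// => i _.
  by rewrite -expr2 sqr_ge0.
have qfin : q \is a fin_num by exact: fin_num_measure.
have Nq (N : nat) : N%:R * fine q <= n.+1%:R.
  rewrite -lee_fin EFinM fineK//.
  have <- : (\sum_(t < N) mu (H (moment t)) = N%:R%:E * q)%E.
    rewrite (eq_bigr (fun=> q)) => [|t _]; last exact: qE.
    by rewrite -[q]fineK// sumEFin sumr_const card_ord -EFinM mulr_natl.
  rewrite (eq_bigr (fun t : 'I_N => \int[mu]_y (\1_(H (moment t)) y)%:E)%E); last first.
    by move=> t _; rewrite integral_indic// setIT.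
  rewrite -ge0_integral_sum//; last first.
    by move=> t; apply/measurable_EFinP; exact: measurable_indic.
  under eq_integral do rewrite sumEFin.
  rewrite -[leRHS](_ : \int[mu]_y (cst n.+1%:R%:E y) = _)%E; last first.
    transitivity (n.+1%:R%:E * mu setT)%E; first exact: integral_cst.
    by rewrite probability_setT mule1.
  apply: ge0_le_integral => //.
  - by move=> y _; rewrite lee_fin sumr_ge0.
  - apply/measurable_EFinP; apply: measurable_sum => t; exact: measurable_indic.
  - by move=> y _; rewrite lee_fin moment_count.
have q0 : fine q <= 0.
  rewrite leNgt; apply/negP => q0.
  have := Nq (Num.truncn (n.+1%:R / fine q)).+1.
  by rewrite leNgt => /negP; apply; rewrite -ltr_pdivrMr// truncnS_gt.
apply/eqP; rewrite eq_le measure_ge0 andbT -[q]fineK//.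
Qed.

End hyperplanes.

(** * Fubini's theorem for bounded functions and finite measures *)

Section bounded_fubini.
Context d1 d2 (T1 : measurableType d1) (T2 : measurableType d2) (R : realType).
Variables (m1 : {finite_measure set T1 -> \bar R}) (m2 : {finite_measure set T2 -> \bar R}).
Variables (F : T1 * T2 -> R) (c : R).
Hypotheses (mF : measurable_fun setT F) (Fc : forall z, `|F z| <= c).

Lemma bounded_integrable_prod : (m1 \x m2)%E.-integrable setT (EFin \o F).
Proof.
apply: measurable_bounded_integrable => //.
  rewrite -setXTT; apply: (@le_lt_trans _ _ (m1 setT * m2 setT)%E).
    by rewrite le_eqVlt; apply/orP; left; apply/eqP; exact: product_measure1E.
  by rewrite ltey_eq fin_numM// fin_num_measure.
exists c; split; first exact: num_real.
by move=> e ce x _ /=; rewrite (le_trans (Fc _))// ltW.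
Qed.

Lemma measurable_slice1 x : measurable_fun setT (fun y => F (x, y)).
Proof. exact: measurableT_comp mF (measurable_pair1 x). Qed.

Lemma measurable_slice2 y : measurable_fun setT (fun x => F (x, y)).
Proof. exact: measurableT_comp mF (measurable_pair2 y). Qed.

Lemma EFin_Rintegral1 x : (Rintegral m2 setT (fun y => F (x, y)))%:E =
  (\int[m2]_y (F (x, y))%:E)%E.
Proof.
rewrite fineK//; apply: integrable_fin_num => //.
apply: (bounded_integrable _ measurableT (measurable_slice1 x)) => y _; exact: Fc.
Qed.

Lemma EFin_Rintegral2 y : (Rintegral m1 setT (fun x => F (x, y)))%:E =
  (\int[m1]_x (F (x, y))%:E)%E.
Proof.
rewrite fineK//; apply: integrable_fin_num => //.
apply: (bounded_integrable _ measurableT (measurable_slice2 y)) => x _; exact: Fc.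
Qed.

Lemma measurable_Rintegral1 :
  measurable_fun setT (fun x => Rintegral m2 setT (fun y => F (x, y))).
Proof.
(* Adding [c] makes the function nonnegative, so Tonelli's theorem yields measurability from [m2]
   alone; [measurable_gram] uses this with pairs of points as parameter. *)
have Fc0 z : (0 <= (F z + c)%:E)%E.
  by rewrite lee_fin -lerBlDr sub0r; have := Fc z; rewrite ler_norml => /andP[].
have mFc : measurable_fun setT (fun z => (F z + c)%:E).
  by apply/measurable_EFinP; exact: measurable_funD.
have ic : m2.-integrable setT (EFin \o cst c).
  exact: (@bounded_integrable _ _ _ _ _ `|c|).
have iF x : m2.-integrable setT (EFin \o (fun y => F (x, y))).
  apply: (bounded_integrable _ measurableT (measurable_slice1 x)) => y _; exact: Fc.
rewrite (_ : (fun x => _) = (fun x => fine (\int[m2]_y (F (x, y) + c)%:E)%E -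
    Rintegral m2 setT (cst c))).
  apply: measurable_funB => //; apply: (measurableT_comp (fine_measurable _)) => //.
  exact: (@measurable_fun_fubini_tonelli_F _ _ _ _ _ m2 _ mFc Fc0).
apply/funext => x; rewrite -[fine _]/(Rintegral m2 setT (fun y => F (x, y) + c)).
by rewrite RintegralD// addrK.
Qed.

Lemma measurable_Rintegral2 :
  measurable_fun setT (fun y => Rintegral m1 setT (fun x => F (x, y))).
Proof.
apply/measurable_EFinP; have := measurable_fubini_G bounded_integrable_prod.
by apply: eq_measurable_fun => x _ /=; rewrite EFin_Rintegral2.
Qed.

Lemma Rintegral_prod1 : Rintegral (m1 \x m2)%E setT F =
  Rintegral m1 setT (fun x => Rintegral m2 setT (fun y => F (x, y))).
Proof.
congr fine; rewrite -(integral12_prod_meas1 bounded_integrable_prod).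
by apply: eq_integral => x _; rewrite EFin_Rintegral1.
Qed.

Lemma Rintegral_prod2 : Rintegral (m1 \x m2)%E setT F =
  Rintegral m2 setT (fun y => Rintegral m1 setT (fun x => F (x, y))).
Proof.
congr fine; rewrite -(integral21_prod_meas1 bounded_integrable_prod).
by apply: eq_integral => x _; rewrite EFin_Rintegral2.
Qed.

End bounded_fubini.

(** * Decay of the Gram kernels *)

Section gram_decay.
Context (R : realType) (m : nat).
Local Notation S := (sphere R m.+2).
Variable mu : probability S R.
Hypothesis inv : rotation_invariant mu.

Definition gram (g : R -> R) (x y : S) : R :=
  Rintegral mu setT (fun z => g (dot (sval x) (sval z)) * g (dot (sval y) (sval z))).

Section bounded.
Variable g : R -> R.
Hypotheses (mg : measurable_fun setT g) (g1 : forall t, `|g t| <= 1).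

Lemma gram_integrand_le1 a b : `|g a * g b| <= 1.
Proof. by rewrite normrM mulr_ile1. Qed.

Lemma measurable_gram_integrand (x y : 'rV[R]_m.+3) :
  measurable_fun setT (fun z : S => g (dot x (sval z)) * g (dot y (sval z))).
Proof.
apply: measurable_funM.
  exact: (measurableT_comp mg (measurable_dotr x)).
exact: (measurableT_comp mg (measurable_dotr y)).
Qed.

Lemma gram_le1 x y : `|gram g x y| <= 1.
Proof.
apply: Rintegral_probability_le1; first exact: measurable_gram_integrand.
by move=> z; exact: gram_integrand_le1.
Qed.

Lemma measurable_gram : measurable_fun setT (fun z : S * S => gram g z.1 z.2).
Proof.
pose F (u : (S * S) * S) := g (dot (sval u.1.1) (sval u.2)) * g (dot (sval u.1.2) (sval u.2)).
have mF : measurable_fun setT F.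
  apply: measurable_funM.
  - apply: (measurableT_comp mg); apply: measurable_dot_sphere; first exact: measurable_snd.
    move=> i; apply: (measurableT_comp (measurable_coord i)).
    exact: (measurableT_comp measurable_fst measurable_fst).
  - apply: (measurableT_comp mg); apply: measurable_dot_sphere; first exact: measurable_snd.
    move=> i; apply: (measurableT_comp (measurable_coord i)).
    exact: (measurableT_comp measurable_snd measurable_fst).
have F1 u : `|F u| <= 1 by exact: gram_integrand_le1.
exact: (measurable_Rintegral1 mu mF F1).
Qed.

Lemma gram_rotate Q (QQ : Q *m Q^T = 1%:M) x y : \det Q = 1 ->
  gram g (rotate QQ x) (rotate QQ y) = gram g x y.
Proof.
move=> dQ; rewrite /gram -[LHS](Rintegral_rotate inv QQ (c := 1) dQ).
- by apply: eq_Rintegral => z _ /=; rewrite !dot_orthogonal.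
- exact: measurable_gram_integrand.
- by move=> z; exact: gram_integrand_le1.
Qed.

End bounded.

Let e0 : S := exist (fun x : 'rV[R]_m.+3 => norm2 x == 1) _ (@sphere_point R m.+2).

Lemma Rintegral_segment01_cst (c : R) :
  Rintegral (segment_measure 0 1) setT (cst c) = c.
Proof.
have s1 : segment_measure (0 : R) 1 setT = 1%E.
  transitivity (lebesgue_measure (setT `&` `[0, 1]%classic : set R)) => //.
  by rewrite setTI lebesgue_measure_itv/= lte_fin ltr01 oppr0 adde0.
transitivity (c * fine (segment_measure 0 1 setT)); first exact: Rintegral_cst.
by rewrite s1 mulr1.
Qed.

Let dot_circle (x z : 'rV[R]_m.+3) t :
  dot x (z *m plane_rotation 1 2%:R (circle_cos t) (circle_sin t)) =
  (dot x z - (x 0 1 * z 0 1 + x 0 2%:R * z 0 2%:R)) +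
  (x 0 1 * z 0 1 + x 0 2%:R * z 0 2%:R) * circle_cos t +
  (x 0 2%:R * z 0 1 - x 0 1 * z 0 2%:R) * circle_sin t.
Proof. exact: dot_plane_rotation. Qed.

Lemma measurable_dot_circle (g : R -> R) (y : 'rV[R]_m.+3) : measurable_fun setT g ->
  measurable_fun setT (fun u : S * measurableTypeR R =>
    g (dot y (sval u.1 *m plane_rotation 1 2%:R (circle_cos u.2) (circle_sin u.2)))).
Proof.
move=> mg; apply: (measurableT_comp mg); under eq_fun do rewrite dot_circle.
have mc (w : R -> R) : measurable_fun setT w ->
    measurable_fun setT (fun u : S * measurableTypeR R => w u.2).
  move=> mw; apply: (measurableT_comp mw); exact: measurable_snd.
have md (v : 'rV[R]_m.+3) :
    measurable_fun setT (fun u : S * measurableTypeR R => dot v (sval u.1)).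
  exact: (measurableT_comp (measurable_dotr _) measurable_fst).
have mi i : measurable_fun setT (fun u : S * measurableTypeR R => sval u.1 0 i).
  exact: (measurableT_comp (measurable_coord i) measurable_fst).
apply: measurable_funD; [apply: measurable_funD|].
- apply: measurable_funB => //.
  by apply: measurable_funD; apply: measurable_funM.
- apply: measurable_funM; last exact: (mc _ (@measurable_circle_cos R)).
  by apply: measurable_funD; apply: measurable_funM.
- apply: measurable_funM; last exact: (mc _ (@measurable_circle_sin R)).
  by apply: measurable_funB; apply: measurable_funM.
Qed.

(* Averaging over the rotations of the plane of the coordinates 1 and 2, which
   fix the point [e0]. *)
Lemma gram_circle (g : R -> R) (y : S) :
  measurable_fun setT g -> (forall t, `|g t| <= 1) ->
  gram g e0 y = Rintegral mu setT (fun z => g (dot (sval e0) (sval z)) *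
    Rintegral (segment_measure 0 1) setT (fun t =>
      g (dot (sval y) (sval z *m plane_rotation 1 2%:R (circle_cos t) (circle_sin t))))).
Proof.
move=> mg g1.
pose F (u : S * measurableTypeR R) := g (dot (sval e0) (sval u.1)) *
  g (dot (sval y) (sval u.1 *m plane_rotation 1 2%:R (circle_cos u.2) (circle_sin u.2))).
have mF : measurable_fun setT F.
  apply: measurable_funM; last exact: measurable_dot_circle.
  apply: (measurableT_comp mg).
  exact: (measurableT_comp (measurable_dotr _) measurable_fst).
have F1 u : `|F u| <= 1 by exact: gram_integrand_le1.
have iG z : (segment_measure 0 1).-integrable setT (EFin \o (fun t =>
    g (dot (sval y) (sval z *m plane_rotation 1 2%:R (circle_cos t) (circle_sin t))))).
  apply: (@bounded_integrable _ _ _ _ _ 1) => //.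
  apply: (measurableT_comp mg); under eq_fun do rewrite dot_circle.
  exact: measurable_circle.
transitivity (Rintegral (segment_measure 0 1) setT
    (fun t => Rintegral mu setT (fun z => F (z, t)))); last first.
  rewrite -(Rintegral_prod2 _ _ mF F1) (Rintegral_prod1 _ _ mF F1).
  by apply: eq_Rintegral => z _; rewrite -RintegralZl.
rewrite -[LHS]Rintegral_segment01_cst; apply: eq_Rintegral => t _ /=.
have i12 : (1 : 'I_m.+3) != 2%:R by [].
have QQ := plane_rotation_orthogonal i12 (circle_cos2D_sin2 t).
rewrite /gram -[LHS](Rintegral_rotate inv QQ (c := 1)).
- apply: eq_Rintegral => z _ /=; rewrite /F /=; congr (g _ * _).
  by rewrite dot_circle !mxE/=; ring.
- exact: det_circle_rotation.
- exact: measurable_gram_integrand.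
- by move=> z; exact: gram_integrand_le1.
Qed.
Section decay.
Variable g : nat -> R -> R.
Hypotheses (mg : forall k, measurable_fun setT (g k)) (g1 : forall k t, `|g k t| <= 1).
Hypothesis g0 : forall x,
  Rintegral (segment_measure (-1) 1) `]-oo, x[ (g k) @[k --> \oo] --> 0.

Lemma dot_orthogonal_sphere (y z : S) (Q : 'M[R]_m.+3) : Q *m Q^T = 1%:M ->
  dot (sval y) (sval z *m Q) \in `[-1, 1].
Proof. by move=> QQ; rewrite -[sval z *m Q]/(sval (rotate QQ z)); exact: dot_itv. Qed.

(** The coefficients p, q of cosine and sine satisfy p^2 + q^2 = (y_1^2 + y_2^2) (z_1^2 + z_2^2):
    they do not both vanish when [y] and [z] have nonzero projections on the plane of rotation. *)
Lemma gram_circle_cvg0 (y z : S) : sval y 0 1 != 0 -> sval z 0 1 != 0 ->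
  Rintegral (segment_measure 0 1) setT (fun t => g k (dot (sval y)
    (sval z *m plane_rotation 1 2%:R (circle_cos t) (circle_sin t)))) @[k --> \oo] --> 0.
Proof.
move=> y1 z1.
under eq_fun do under eq_Rintegral do rewrite dot_circle.
apply: circle_weak_cvg => //; last first.
  move=> t; rewrite -dot_circle; apply: dot_orthogonal_sphere.
  exact: plane_rotation_orthogonal (circle_cos2D_sin2 t).
apply/eqP => -[p0 q0].
have : (sval y 0 1 ^+ 2 + sval y 0 2%:R ^+ 2) * (sval z 0 1 ^+ 2 + sval z 0 2%:R ^+ 2) = 0.
  transitivity ((sval y 0 1 * sval z 0 1 + sval y 0 2%:R * sval z 0 2%:R) ^+ 2 +
     (sval y 0 2%:R * sval z 0 1 - sval y 0 1 * sval z 0 2%:R) ^+ 2); first by ring.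
  by rewrite p0 q0 expr0n addr0.
apply/eqP; rewrite mulf_neq0// gt_eqF// ltr_wpDr ?sqr_ge0// exprn_even_gt0//.
Qed.

Lemma coord1_neq0_ae : {ae mu, forall z : S, sval z 0 1 != 0}.
Proof.
have := hyperplane_null inv (v := delta_mx 0 1); rewrite dot_delta mxE !eqxx oner_neq0.
move=> /(_ isT) H0; exists [set y | dot (delta_mx 0 1) (sval y) = 0]; split => //.
- have -> : [set y : S | dot (delta_mx 0 1) (sval y) = 0] =
    (fun y : S => dot (delta_mx 0 1) (sval y)) @^-1` [set 0] by [].
  by rewrite -[_ @^-1` _]setTI; exact: measurable_dotr.
- by move=> z /= /negP; rewrite negbK dot_delta => /eqP.
Qed.

Lemma gram_e0_cvg0 (y : S) : sval y 0 1 != 0 -> gram (g k) e0 y @[k --> \oo] --> 0.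
Proof.
move=> y1; under eq_fun do rewrite gram_circle//.
pose I k (z : S) := Rintegral (segment_measure 0 1) setT (fun t => g k (dot (sval y)
    (sval z *m plane_rotation 1 2%:R (circle_cos t) (circle_sin t)))).
have mF k := @measurable_dot_circle (g k) (sval y) (mg k).
have I1 k z : `|I k z| <= 1.
  rewrite -[leRHS](Rintegral_segment01_cst 1).
  have := @le_Rintegral_bounded _ _ _ (segment_measure 0 1) _ 1 _ measurableT
    (measurable_slice1 (mF k) z) (fun t _ => g1 k _).
  move/le_trans; apply; rewrite mul1r.
  by have := Rintegral_segment01_cst 1; rewrite Rintegral_cst// mul1r => ->.
apply: (@Rintegral_bounded_cvg0 _ _ _ mu _ 1) => [k|k z|].
- apply: measurable_funM.
    exact: (measurableT_comp (mg k) (measurable_dotr _)).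
  exact: (measurable_Rintegral1 (segment_measure 0 1) (mF k) (fun u => g1 k _)).
- by rewrite normrM mulr_ile1//; exact: I1.
- apply: filterS coord1_neq0_ae => z z1; apply/cvgr0Pnorm_le => e e0'.
  have /cvgr0Pnorm_le/(_ e e0') := gram_circle_cvg0 y1 z1.
  by apply: filterS => k; apply: le_trans; rewrite normrM ler_piMl.
Qed.

(** Rotations act transitively and preserve [gram], so the mean over [y] does not depend on [x]; one
    may take x = [e0], where dominated convergence applies. *)
Lemma gram_cvg0 :
  Rintegral (mu \x mu)%E setT (fun z => `|gram (g k) z.1 z.2|) @[k --> \oo] --> 0.
Proof.
have mG k : measurable_fun setT (fun z : S * S => `|gram (g k) z.1 z.2|).
  by apply: measurableT_comp => //; exact: measurable_gram.
have G1 k (z : S * S) : `| `|gram (g k) z.1 z.2| | <= 1 by rewrite normr_id gram_le1.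
rewrite [X in X @ _ --> _](_ : _ = fun k => Rintegral mu setT (fun y => `|gram (g k) e0 y|)).
  apply: (@Rintegral_bounded_cvg0 _ _ _ mu _ 1) => [k|k y|].
  - exact: measurable_slice1 (mG k) e0.
  - exact: G1 k (e0, y).
  - apply: filterS coord1_neq0_ae => y y1; rewrite -(normr0 R).
    exact: cvg_norm (gram_e0_cvg0 y1).
apply/funext => k; rewrite (Rintegral_prod1 mu mu (mG k) (G1 k)).
have -> : Rintegral mu setT (fun y => `|gram (g k) e0 y|) =
    Rintegral mu setT (cst (Rintegral mu setT (fun y => `|gram (g k) e0 y|))).
  by rewrite Rintegral_probability_cst.
apply: eq_Rintegral => x _ /=.
have [Q [QQ dQ Qx]] := rotation_transitive (dot_sphere x).
have xE : x = rotate QQ e0 by apply/val_inj; rewrite /= Qx.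
rewrite xE -[LHS](Rintegral_rotate inv QQ (c := 1) dQ).
- by apply: eq_Rintegral => y _; rewrite gram_rotate.
- exact: measurable_slice1 (mG k) _.
- by move=> y; exact: G1 k (_, y).
Qed.

End decay.
End gram_decay.

(** * The cut norm *)

Section cut_norm_gram.
Context (R : realType) (m : nat).
Local Notation S := (sphere R m.+2).
Variable mu : probability S R.
Variable g : R -> R.
Hypotheses (mg : measurable_fun setT g) (g1 : forall t, `|g t| <= 1).

Let M (z : S * S) := g (dot (sval z.1) (sval z.2)).

Let mM : measurable_fun setT M.
Proof. exact: (measurableT_comp mg (@measurable_dot_prod R m.+2)). Qed.

Let M1 z : `|M z| <= 1. Proof. exact: g1. Qed.

(** The difference of the two sides is the variance of [u]. *)
Lemma sqr_Rintegral_le d (T : measurableType d) (P : probability T R) (u : T -> R) :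
  measurable_fun setT u -> (forall x, `|u x| <= 1) ->
  (Rintegral P setT u) ^+ 2 <= Rintegral P setT (fun x => u x ^+ 2).
Proof.
move=> mu_ u1; set c := Rintegral P setT u.
have iu : P.-integrable setT (EFin \o u) by apply: (@bounded_integrable _ _ _ _ _ 1).
have iu2 : P.-integrable setT (EFin \o (fun x => u x ^+ 2)).
  apply: (@bounded_integrable _ _ _ _ _ 1) => //; first exact: measurable_funX.
  by move=> x _; rewrite normrX exprn_ile1.
have : 0 <= Rintegral P setT (fun x => (u x - c) ^+ 2).
  by apply: Rintegral_ge0 => x _; rewrite sqr_ge0.
rewrite (_ : Rintegral P setT (fun x => (u x - c) ^+ 2) =
    Rintegral P setT (fun x => u x ^+ 2) - c ^+ 2) ?subr_ge0//.
transitivity (Rintegral P setT (fun x => u x ^+ 2 - (2 * c * u x - cst (c ^+ 2) x))).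
  by apply: eq_Rintegral => x _ /=; ring.
have icu : P.-integrable setT (EFin \o (fun x => 2 * c * u x)).
  exact: (integrableZl measurableT (2 * c) iu).
have ic : P.-integrable setT (EFin \o cst (c ^+ 2)).
  exact: (@bounded_integrable _ _ _ _ _ `|c ^+ 2|).
rewrite RintegralB//; last exact: (integrableB measurableT icu ic).
by rewrite RintegralB// Rintegral_probability_cst RintegralZl// -/c; ring.
Qed.

(** Cauchy-Schwarz in x removes [a] and leaves the integral of the square of [T x], the integral of
    b (y) M (x, y) over y. Expanding the square and integrating over x first produces the Gram
    kernel against b (y) b (w). *)
Lemma bilinear_le_gram (a b : S -> R) :
  measurable_fun setT a -> (forall x, `|a x| <= 1) ->
  measurable_fun setT b -> (forall x, `|b x| <= 1) ->
  `|Rintegral (mu \x mu)%E setT (fun z => a z.1 * b z.2 * M z)| <=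
  Num.sqrt (Rintegral (mu \x mu)%E setT (fun z => `|gram mu g z.1 z.2|)).
Proof.
move=> ma a1 mb b1.
have ma1 : measurable_fun setT (fun z : S * S => a z.1).
  exact: (measurableT_comp ma measurable_fst).
have mb1 : measurable_fun setT (fun z : S * S => b z.1).
  exact: (measurableT_comp mb measurable_fst).
have mb2 : measurable_fun setT (fun z : S * S => b z.2).
  exact: (measurableT_comp mb measurable_snd).
rewrite -sqrtr_sqr ler_wsqrtr//.
have mbM : measurable_fun setT (fun z : S * S => b z.2 * M z).
  exact: measurable_funM.
have bM1 (z : S * S) : `|b z.2 * M z| <= 1 by rewrite normrM mulr_ile1.
pose T x := Rintegral mu setT (fun y => b y * M (x, y)).
have mT : measurable_fun setT T := measurable_Rintegral1 mu mbM bM1.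
have T1 x : `|T x| <= 1.
  exact: (Rintegral_probability_le1 mu (measurable_slice1 mbM x) (fun y => bM1 (x, y))).
have mabM : measurable_fun setT (fun z : S * S => a z.1 * b z.2 * M z).
  by apply: measurable_funM => //; exact: measurable_funM.
have abM1 (z : S * S) : `|a z.1 * b z.2 * M z| <= 1.
  by rewrite -mulrA normrM mulr_ile1.
have ibM x : mu.-integrable setT (EFin \o (fun y => b y * M (x, y))).
  apply: (@bounded_integrable _ _ _ _ _ 1) => //; first exact: (measurable_slice1 mbM x).
  by move=> y _; exact: bM1 (x, y).
rewrite (Rintegral_prod1 mu mu mabM abM1) /=.
rewrite (@eq_Rintegral _ _ _ mu setT (fun x => a x * T x)); last first.
  move=> x _; rewrite /T -RintegralZl//.
  by apply: eq_Rintegral => y _; rewrite mulrA.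
apply: (@le_trans _ _ (Rintegral mu setT (fun x => T x ^+ 2))).
  have maT : measurable_fun setT (fun x => a x * T x) by exact: measurable_funM.
  have aT1 x : `|a x * T x| <= 1 by rewrite normrM mulr_ile1.
  apply: (le_trans (sqr_Rintegral_le mu maT aT1)); apply: le_Rintegral => //.
  - apply: (@bounded_integrable _ _ _ _ _ 1) => //; first exact: measurable_funX.
    by move=> x _; rewrite normrX exprn_ile1.
  - apply: (@bounded_integrable _ _ _ _ _ 1) => //; first exact: measurable_funX.
    by move=> x _; rewrite normrX exprn_ile1.
  - by move=> x _; rewrite exprMn ler_piMl ?sqr_ge0// -real_normK ?num_real// exprn_ile1.
have mT1 : measurable_fun setT (fun z : S * S => T z.1).
  exact: (measurableT_comp mT measurable_fst).
have mbMT : measurable_fun setT (fun z : S * S => b z.2 * M z * T z.1).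
  exact: measurable_funM.
have bMT1 (z : S * S) : `|b z.2 * M z * T z.1| <= 1 by rewrite normrM mulr_ile1.
have mG := measurable_gram mu mg g1.
have mbG : measurable_fun setT (fun z : S * S => b z.1 * b z.2 * gram mu g z.1 z.2).
  by apply: measurable_funM => //; exact: measurable_funM.
have bG1 (z : S * S) : `|b z.1 * b z.2 * gram mu g z.1 z.2| <= 1.
  by rewrite -mulrA normrM mulr_ile1// normrM mulr_ile1// gram_le1.
have -> : Rintegral mu setT (fun x => T x ^+ 2) =
    Rintegral (mu \x mu)%E setT (fun z => b z.1 * b z.2 * gram mu g z.1 z.2).
  transitivity (Rintegral mu setT (fun x => Rintegral mu setT (fun y => b y * M (x, y) * T x))).
    by apply: eq_Rintegral => x _; rewrite RintegralZr.
  rewrite -(Rintegral_prod1 mu mu mbMT bMT1) (Rintegral_prod2 mu mu mbMT bMT1).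
  rewrite (Rintegral_prod1 mu mu mbG bG1); apply: eq_Rintegral => y _ /=.
  (* With [y] fixed, this is the integrand in x and in the second variable w of the expanded square;
     exchanging these two integrals makes [gram] appear. *)
  pose K (z : S * S) := b z.2 * (g (dot (sval y) (sval z.1)) * M z).
  have mgy : measurable_fun setT (fun z : S * S => g (dot (sval y) (sval z.1))).
    exact: (measurableT_comp mg (measurableT_comp (measurable_dotr _) measurable_fst)).
  have mK : measurable_fun setT K.
    by apply: measurable_funM => //; exact: measurable_funM.
  have K1 z : `|K z| <= 1 by rewrite normrM mulr_ile1// normrM mulr_ile1.
  have iK1 := bounded_integrable mu measurableT (measurable_Rintegral1 mu mK K1)
    (fun x _ => Rintegral_probability_le1 mu (measurable_slice1 mK x) (fun w => K1 (x, w))).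
  have iK2 := bounded_integrable mu measurableT (measurable_Rintegral2 mu mu mK K1)
    (fun w _ => Rintegral_probability_le1 mu (measurable_slice2 mK w) (fun x => K1 (x, w))).
  transitivity (b y * Rintegral mu setT (fun x => Rintegral mu setT (fun w => K (x, w)))).
    rewrite -(RintegralZl (b y) measurableT iK1).
    apply: eq_Rintegral => x _; rewrite -mulrA; congr (_ * _).
    rewrite /T -RintegralZl//; apply: eq_Rintegral => w _.
    by rewrite /K /M /= (dotC (sval y)); ring.
  rewrite -(Rintegral_prod1 mu mu mK K1) (Rintegral_prod2 mu mu mK K1).
  rewrite -(RintegralZl (b y) measurableT iK2).
  apply: eq_Rintegral => w _; rewrite -mulrA; congr (_ * _).
  rewrite /gram -RintegralZl//; last first.
    apply: (@bounded_integrable _ _ _ _ _ 1) => //; first exact: measurable_gram_integrand.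
    by move=> x _; exact: gram_integrand_le1.
  by apply: eq_Rintegral => x _; rewrite /K /M /= (dotC (sval w)).
have mGa : measurable_fun setT (fun z : S * S => `|gram mu g z.1 z.2|).
  exact: measurableT_comp.
apply: (le_trans (ler_norm _)).
apply: (le_trans (le_normr_Rintegral _ _)) => //; first exact: (bounded_integrable_prod mu mu mbG bG1).
apply: le_Rintegral => //.
- apply: (integrable_abse (bounded_integrable_prod mu mu mbG bG1)).
- apply: (bounded_integrable_prod mu mu mGa (c := 1)) => z.
  by rewrite normr_id gram_le1.
- move=> z _; rewrite normrM ler_piMl// normrM mulr_ile1//.
Qed.

Let gram_norm := Num.sqrt (Rintegral (mu \x mu)%E setT (fun z => `|gram mu g z.1 z.2|)).

Let ae_prod (a b : S -> R) : {ae mu, forall x, `|a x| <= 1} ->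
  {ae mu, forall x, `|b x| <= 1} ->
  {ae (mu \x mu)%E, forall z : S * S, `|a z.1| <= 1 /\ `|b z.2| <= 1}.
Proof. by move=> /ae_fst a1 /ae_snd b1; apply: filterS2 a1 b1 => z; split. Qed.

Let measurable_prodM (a b : S -> R) : measurable_fun setT a -> measurable_fun setT b ->
  measurable_fun setT (fun z : S * S => a z.1 * b z.2).
Proof.
move=> ma mb; apply: measurable_funM.
  exact: (measurableT_comp ma measurable_fst).
exact: (measurableT_comp mb measurable_snd).
Qed.

(** Test functions of the cut norm are bounded by 1 only almost everywhere; clamping them to [-1, 1]
    alters no integral. *)
Lemma bilinear_le_gram_ae (a b : S -> R) :
  measurable_fun setT a -> {ae mu, forall x, `|a x| <= 1} ->
  measurable_fun setT b -> {ae mu, forall x, `|b x| <= 1} ->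
  `|Rintegral (mu \x mu)%E setT (fun z => a z.1 * b z.2 * M z)| <= gram_norm.
Proof.
move=> ma a1 mb b1.
pose clamp (t : R) := Num.max (-1) (Num.min 1 t).
have clamp1 t : `|clamp t| <= 1.
  by rewrite ler_norml /clamp le_max lexx/= ge_max ge_min lexx andbT -subr_ge0 opprK addr_ge0.
have clampE t : `|t| <= 1 -> clamp t = t.
  by rewrite ler_norml /clamp => /andP[t0 t1]; rewrite min_r// max_r.
have mclamp (u : S -> R) : measurable_fun setT u -> measurable_fun setT (clamp \o u).
  move=> mu_; apply: measurable_maxr => //; exact: measurable_minr.
apply: le_trans (bilinear_le_gram (mclamp _ ma) (fun x => clamp1 _) (mclamp _ mb) (fun x => clamp1 _)).
rewrite le_eqVlt; apply/orP; left; apply/eqP; congr `| fine _ |.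
apply: ae_eq_integral => //.
- apply/measurable_EFinP; apply: measurable_funM => //; exact: measurable_prodM.
- apply/measurable_EFinP; apply: measurable_funM => //.
  by apply: measurable_prodM; exact: mclamp.
- by apply: filterS (ae_prod a1 b1) => z [az bz] _ /=; rewrite !clampE.
Qed.

(** Real and imaginary parts of the complex form are each a sum or difference of two real bilinear
    forms, hence at most 2 [gram_norm] in modulus. The modulus is then at most the square root of 8
    times [gram_norm], rounded up to 4. *)
Lemma cut_norm_le_gram : cut_norm mu (spherical_kernel g) <= 4 * gram_norm.
Proof.
have iM : (mu \x mu)%E.-integrable setT (EFin \o M) := bounded_integrable_prod mu mu mM M1.
apply: cut_norm_le => f h [[f1 f2] /ess_supP fle] [[h1 h2] /ess_supP hle].
have ae_re (u : S -> R[i]) : {ae mu, forall x, ((normc (u x))%:E <= 1)%E} ->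
    {ae mu, forall x, `|complex.Re (u x)| <= 1}.
  by apply: filterS => x; rewrite lee_fin; apply: le_trans; exact: Re_le.
have ae_im (u : S -> R[i]) : {ae mu, forall x, ((normc (u x))%:E <= 1)%E} ->
    {ae mu, forall x, `|complex.Im (u x)| <= 1}.
  by apply: filterS => x; rewrite lee_fin; apply: le_trans; exact: Im_le.
have fr := ae_re _ fle; have fi := ae_im _ fle.
have hr := ae_re _ hle; have hi := ae_im _ hle.
have iP (a b : S -> R) : measurable_fun setT a -> {ae mu, forall x, `|a x| <= 1} ->
    measurable_fun setT b -> {ae mu, forall x, `|b x| <= 1} ->
    (mu \x mu)%E.-integrable setT (EFin \o (fun z => a z.1 * b z.2 * M z)).
  move=> ma a1 mb b1; apply: integrable_wtM => //; first exact: measurable_prodM.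
  by apply: filterS (ae_prod a1 b1) => z [az bz]; rewrite normrM mulr_ile1.
rewrite cut_formE.
have -> : Rintegral (mu \x mu)%E setT (fun z => complex.Re (cut_weight f h z) * spherical_kernel g z) =
    Rintegral (mu \x mu)%E setT (fun z => complex.Re (f z.1) * complex.Re (h z.2) * M z) +
    Rintegral (mu \x mu)%E setT (fun z => complex.Im (f z.1) * complex.Im (h z.2) * M z).
  rewrite -RintegralD//; [|exact: iP f1 fr h1 hr|exact: iP f2 fi h2 hi].
  apply: eq_Rintegral => z _; rewrite /cut_weight /spherical_kernel /M.
  by case: (f _) (h _) => [a1 a2] [b1 b2] /=; ring.
have -> : Rintegral (mu \x mu)%E setT (fun z => complex.Im (cut_weight f h z) * spherical_kernel g z) =
    Rintegral (mu \x mu)%E setT (fun z => complex.Re (f z.1) * complex.Im (h z.2) * M z) -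
    Rintegral (mu \x mu)%E setT (fun z => complex.Im (f z.1) * complex.Re (h z.2) * M z).
  rewrite -RintegralB//; [|exact: iP f1 fr h2 hi|exact: iP f2 fi h1 hr].
  apply: eq_Rintegral => z _; rewrite /cut_weight /spherical_kernel /M.
  by case: (f _) (h _) => [a1 a2] [b1 b2] /=; ring.
have := bilinear_le_gram_ae f1 fr h1 hr; have := bilinear_le_gram_ae f2 fi h2 hi.
have := bilinear_le_gram_ae f1 fr h2 hi; have := bilinear_le_gram_ae f2 fi h1 hr.
set t1 := Rintegral _ _ _; set t2 := Rintegral _ _ _; set t3 := Rintegral _ _ _.
set t4 := Rintegral _ _ _ => H1 H2 H3 H4 /=.
have g0 : 0 <= gram_norm by exact: sqrtr_ge0.
rewrite -[leRHS]ger0_norm ?mulr_ge0// -sqrtr_sqr ler_wsqrtr//.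
have sq (u v w : R) : `|u| <= w -> `|v| <= w -> (u + v) ^+ 2 <= (2 * w) ^+ 2.
  move=> uw vw; rewrite -real_normK ?num_real// lerXn2r// ?nnegrE//.
    by rewrite mulr_ge0// (le_trans _ uw).
  by rewrite (le_trans (ler_normD _ _))// mulr_natl mulr2n lerD.
apply: (@le_trans _ _ ((2 * gram_norm) ^+ 2 + (2 * gram_norm) ^+ 2)).
  by apply: lerD; apply: sq => //; rewrite normrN.
by rewrite !exprMn; have := sqr_ge0 gram_norm; lra.
Qed.

End cut_norm_gram.

(** * Densities of Lipschitz primitives *)

Lemma ultra_cvg_compact T (Y : topologicalType) (U : set_system T) (f : T -> Y)
    (K : set Y) : UltraFilter U -> compact K -> U (f @^-1` K) ->
  exists2 p, K p & f @ U --> p.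
Proof.
move=> UU cK UK; have [p [Kp clp]] := cK (f @ U) _ UK.
exists p => // B Bp; have [//|UC] := in_ultra_setVsetC (f @^-1` B) UU.
by have [y [nBy By]] := clp (~` B) B UC Bp.
Qed.

Section density.
Context (R : realType).
Local Notation leb := (@lebesgue_measure R).

(** A Radon-Nikodym density [k] of [nu] can exceed 1 only on a null set, so its minimum with 1 is
    again a density, now bounded everywhere. *)
Lemma dominated_density d (T : measurableType d) (nu : {finite_measure set T -> \bar R})
    (mu : {sigma_finite_measure set T -> \bar R}) :
  (forall A, measurable A -> (nu A <= mu A)%E) ->
  exists f : T -> R, [/\ measurable_fun setT f, (forall x, 0 <= f x <= 1) &
    forall A, measurable A -> nu A = (\int[mu]_(x in A) (f x)%:E)%E].
Proof.
move=> numu.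
have dom : nu `<< mu.
  apply/null_content_dominatesP => A mA A0; apply/eqP.
  by rewrite eq_le measure_ge0 andbT -A0 numu.
pose k := fine \o Radon_Nikodym_SigmaFinite.f nu mu.
have kE x : (k x)%:E = Radon_Nikodym_SigmaFinite.f nu mu x.
  by rewrite /k /= fineK// Radon_Nikodym_SigmaFinite.f_fin_num.
have k0 x : 0 <= k x by rewrite -lee_fin kE Radon_Nikodym_SigmaFinite.f_ge0.
have mk : measurable_fun setT k.
  apply/measurable_EFinP; rewrite (_ : _ \o _ = Radon_Nikodym_SigmaFinite.f nu mu).
    exact: measurable_int (Radon_Nikodym_SigmaFinite.f_integrable dom).
  by apply/funext => x; rewrite -kE.
have kint A : measurable A -> nu A = (\int[mu]_(x in A) (k x)%:E)%E.
  move=> mA; rewrite (Radon_Nikodym_SigmaFinite.f_integral dom mA).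
  by apply: eq_integral => x _; rewrite kE.
pose f x := Num.min (k x) 1.
have mf : measurable_fun setT f by exact: measurable_minr.
exists f; split => // [x|A mA].
  by rewrite /f le_min k0 ler01/= ge_min lexx orbT.
pose B := [set x | 1 < k x].
have mB : measurable B.
  have -> : B = k @^-1` `]1, +oo[ by apply/seteqP; split => x; rewrite /B /= in_itv/= andbT.
  by rewrite -[_ @^-1` _]setTI; exact: mk.
have mAB : measurable (A `&` B) by exact: measurableI.
have mAD : measurable (A `\` B) by exact: measurableD.
have f0 D x : D x -> (0 <= (f x)%:E)%E.
  by move=> _; rewrite lee_fin /f le_min k0 ler01.
have mfE D : measurable_fun D (EFin \o f).
  by apply/measurable_EFinP; exact: measurable_funTS.
have mkE D : measurable_fun D (EFin \o k).
  by apply/measurable_EFinP; exact: measurable_funTS.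
rewrite -(setUIDK A B) ge0_integral_setU//; last 2 first.
- exact: f0.
- by apply/disj_setPS => x [[_ Bx] []].
rewrite measureU//; last by apply/seteqP; split => // x [[_ Bx] []].
congr (_ + _)%E; last first.
  apply: (etrans (kint _ mAD)); apply: eq_integral => x; rewrite inE => -[_ /negP].
  by rewrite -leNgt /f => kx; rewrite min_l.
(* Where [k] exceeds 1, [nu] is at least [mu] by integration and at most [mu] by hypothesis; the
   truncated density 1 is therefore correct there. *)
have eB : (\int[mu]_(x in A `&` B) (f x)%:E = mu (A `&` B))%E.
  rewrite -[RHS]mul1e -integral_cst//; apply: eq_integral => x; rewrite inE => -[_ Bx].
  by rewrite /f min_r// ltW.
apply: (etrans _ (esym eB)); apply: le_anti; rewrite numu//=.
rewrite -[leRHS](esym (kint _ mAB)) -[leLHS]mul1e -integral_cst//; apply: ge0_le_integral => //.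
by move=> x [_ Bx]; rewrite lee_fin ltW.
Qed.

Lemma lipschitz1_continuous (F : R -> R) :
  (forall x y, x <= y -> 0 <= F y - F x <= y - x) -> continuous F.
Proof.
move=> F1 x; apply/cvgrPdist_le => e e0; exists e => //= y xy.
apply: (le_trans _ (ltW xy)).
wlog : x y {xy} / x <= y => [wl|xy].
  by have [|/ltW yx] := leP x y; [exact: wl|rewrite distrC (distrC x) wl].
have /andP[h1 h2] := F1 _ _ xy.
by rewrite distrC (distrC x) !ger0_norm// subr_ge0.
Qed.

(** The hypothesis says that F and x - F x are both nondecreasing. Their Stieltjes measures add up
    to Lebesgue measure, as half-open intervals show, so each is bounded by it. *)
Lemma stieltjes_le_lebesgue (F : R -> R) :
  (forall x y, x <= y -> 0 <= F y - F x <= y - x) ->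
  exists m : {measure set (measurableTypeR R) -> \bar R},
    (forall A, measurable A -> (m A <= leb A)%E) /\
    (forall a b, a <= b -> m `]a, b]%classic = (F b - F a)%:E).
Proof.
move=> F1.
have G1 x y : x <= y -> 0 <= (y - F y) - (x - F x) <= y - x.
  by move=> /F1/andP[h1 h2]; apply/andP; split; lra.
have Fnd : nondecreasing F by move=> x y /F1/andP[]; rewrite subr_ge0.
have Gnd : nondecreasing (fun x => x - F x) by move=> x y /G1/andP[]; rewrite subr_ge0.
pose F' : cumulative R R := HB.pack F (isCumulative.Build R _ R F Fnd
  (right_continuousW (lipschitz1_continuous F1))).
pose G' : cumulative R R := HB.pack (fun x => x - F x) (isCumulative.Build R _ R _ Gnd
  (right_continuousW (lipschitz1_continuous G1))).
have itvE (H : cumulative R R) a b : a <= b ->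
    lebesgue_stieltjes_measure H `]a, b]%classic = (H b - H a)%:E.
  move=> ab; rewrite /lebesgue_stieltjes_measure/= /measure_extension.
  by rewrite measurable_mu_extE/=; [|exact: is_ocitv]; rewrite wlength_itv_bnd.
exists (lebesgue_stieltjes_measure F'); split => [A mA|a b ab]; last exact: itvE.
have -> : leb A = measure_add (lebesgue_stieltjes_measure F') (lebesgue_stieltjes_measure G') A.
  apply: lebesgue_stieltjes_measure_unique => // _ [[a b] _ <-] /=.
  apply: (etrans _ (esym (measure_addE _ _ _))); have [ab|ba] := leP a b.
    have E : ((b - a)%:E = (F' b - F' a)%:E + (G' b - G' a)%:E)%E.
      by rewrite -EFinD/=; congr EFin; ring.
    exact: (etrans (itvE idfun _ _ ab) (etrans E
      (esym (f_equal2 _ (itvE F' _ _ ab) (itvE G' _ _ ab))))).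
  by rewrite set_itv_ge ?measure0 ?adde0// bnd_simp -leNgt ltW.
by rewrite [leRHS]measure_addE leeDl.
Qed.

Lemma primitive_density (F : R -> R) :
  (forall x y, x <= y -> 0 <= F y - F x <= y - x) ->
  (forall x, x <= -1 -> F x = 0) -> (forall x, 1 <= x -> F x = F 1) ->
  exists f : R -> R, [/\ measurable_fun setT f, (forall x, 0 <= f x <= 1) &
    forall x, Rintegral (segment_measure (-1) 1) `]-oo, x[ f = F x].
Proof.
move=> F1 FN1 FP1; have [m [mle mitv]] := stieltjes_le_lebesgue F1.
have mI : measurable (`[-1, 1]%classic : set (measurableTypeR R)) by exact: measurable_itv.
have moo : (m `[(-1)%R, 1%R]%classic < +oo)%E.
  by apply: (le_lt_trans (mle _ mI)); exact: lebesgue_segment_lty.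
pose nu : {finite_measure set (measurableTypeR R) -> \bar R} := mfrestr mI moo.
have [|f [mf f01 fint]] := @dominated_density _ (measurableTypeR R) nu (segment_measure (-1) 1).
  by move=> A mA; apply: mle; exact: measurableI.
exists f; split => // x.
have mx : measurable (`]-oo, x[%classic : set (measurableTypeR R)) by exact: measurable_itv.
rewrite /Rintegral -(fint _ mx) (_ : nu _ = (F x)%:E)//.
transitivity (m (`]-oo, x[ `&` `[-1, 1])) => //.
(* [mitv] speaks of half-open intervals, whereas the ray cut by [-1, 1] contains -1 and may omit its
   right end; these points must be null. *)
have m1 (c : R) : m [set c] = 0%E.
  apply/eqP; rewrite eq_le measure_ge0 andbT.
  by apply: (le_trans (mle _ (measurable_set1 _))); rewrite lebesgue_measure_set1.
have [xN1|xN1] := leP x (-1).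
  rewrite (_ : _ `&` _ = set0) ?measure0 ?FN1//.
  by apply/seteqP; split => y //=; rewrite !in_itv/=; lra.
pose x' := Num.min x 1.
have FE : F x = F x'.
  by rewrite /x'; case: (leP x 1) => // /ltW /FP1.
have x'1 : -1 <= x' by rewrite /x' le_min ltW//=; lra.
have mx' : m `]-1, x']%classic = (F x)%:E by rewrite mitv// FE (FN1 (-1))// subr0.
have mU (A B : set (measurableTypeR R)) c : measurable A -> measurable B ->
    A `<=` B `|` [set c] -> (m A <= m B)%E.
  move=> mA mB AB; rewrite -[leRHS]adde0 -(m1 c).
  apply: le_trans (measureU2 _ mB (measurable_set1 c)).
  by apply: le_measure => //; rewrite inE//; exact: measurableU.
have mA : measurable (`]-oo, x[ `&` `[-1, 1] : set (measurableTypeR R)).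
  by apply: measurableI => //; exact: measurable_itv.
have mB : measurable (`]-1, x']%classic : set (measurableTypeR R)) by exact: measurable_itv.
apply/eqP; rewrite eq_le -mx'; apply/andP; split.
  apply: (mU _ _ (-1) mA mB) => y /=; rewrite !in_itv/= => -[yx /andP[y1 y2]].
  have [->|yN1] := eqVneq y (-1); [by right|left].
  by rewrite lt_neqAle eq_sym yN1 y1/= /x' le_min y2 ltW.
apply: (mU _ _ x' mB mA) => y /=; rewrite !in_itv/= => /andP[y1 yx'].
have [->|yN] := eqVneq y x'; [by right|left].
move: yx'; rewrite le_eqVlt (negPf yN)/= /x' lt_min => /andP[-> y2].
by rewrite !ltW.
Qed.

End density.

(** * Primitives of functions with values in [0, 1] *)

Section primitives.
Context (R : realType).

Definition primitive (f : R -> R) (x : R) : R :=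
  Rintegral (segment_measure (-1) 1) `]-oo, x[ f.

Section primitive_lemmas.
Variable f : R -> R.
Hypotheses (mf : measurable_fun setT f) (f01 : forall x, 0 <= f x <= 1).

Let mfS : measurable_fun (setT : set (measurableTypeR R)) f := mf.

Let f1 x : `|f x| <= 1.
Proof. by have /andP[f0 f1] := f01 x; rewrite ger0_norm. Qed.

Let mitv (i : interval R) : measurable ([set` i] : set (measurableTypeR R)).
Proof. exact: measurable_itv. Qed.

Lemma primitiveB x y : x <= y -> primitive f y - primitive f x =
  Rintegral (segment_measure (-1) 1) `[x, y[ f.
Proof.
move=> xy; rewrite /primitive.
have -> : `]-oo, y[%classic = `]-oo, x[ `|` `[x, y[ :> set R.
  apply/seteqP; split => z /=; rewrite !in_itv/=.
    by move=> zy; case: (ltP z x) => zx; [left|right].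
  by case=> [/lt_le_trans->//|/andP[]].
rewrite Rintegral_setU//.
- by rewrite addrAC subrr add0r.
- apply: (@bounded_integrable _ _ _ _ _ 1) => //; last exact: measurable_funTS mfS.
  exact: measurableU.
- apply/disj_setPS => z /=; rewrite !in_itv/= => -[zx /andP[xz _]].
  by move: zx; rewrite ltNge xz.
Qed.

Lemma primitive_lipschitz x y : x <= y -> 0 <= primitive f y - primitive f x <= y - x.
Proof.
move=> xy; rewrite primitiveB//; apply/andP; split.
  by apply: Rintegral_ge0 => z _; have /andP[] := f01 z.
apply: (le_trans (ler_norm _)).
apply: (le_trans (@le_Rintegral_bounded _ _ _ _ _ 1 _ (mitv _) (measurable_funTS mfS) (fun z _ => f1 z))).
rewrite mul1r -lee_fin fineK ?fin_num_measure//.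
apply: (@le_trans _ _ (lebesgue_measure (`[x, y[%classic : set R))).
  by apply: le_measure; rewrite ?inE//; apply: measurableI => //; exact: mitv.
rewrite lebesgue_measure_itv/= lte_fin; case: ltP => // yx.
by rewrite lee_fin subr_ge0.
Qed.

Lemma primitive_le_N1 x : x <= -1 -> primitive f x = 0.
Proof.
move=> xN1; apply/eqP; rewrite -normr_le0.
apply: (le_trans (@le_Rintegral_bounded _ _ _ _ _ 1 _ (mitv _) (measurable_funTS mfS) (fun z _ => f1 z))).
rewrite mul1r (_ : segment_measure _ _ _ = 0%E)//.
transitivity (lebesgue_measure (`]-oo, x[ `&` `[-1, 1]%classic : set R)) => //.
rewrite (_ : _ `&` _ = set0) ?measure0//.
by apply/seteqP; split => y //=; rewrite !in_itv/=; lra.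
Qed.

Lemma primitive_ge1 x : 1 <= x -> primitive f x = primitive f 1.
Proof.
move=> x1; apply/eqP; rewrite -subr_eq0 primitiveB// -normr_le0.
apply: (le_trans (@le_Rintegral_bounded _ _ _ _ _ 1 _ (mitv _) (measurable_funTS mfS) (fun z _ => f1 z))).
rewrite mul1r (_ : segment_measure _ _ _ = 0%E)//.
transitivity (lebesgue_measure (`[1, x[ `&` `[-1, 1]%classic : set R)) => //.
apply: (@subset_measure0 _ _ _ lebesgue_measure _ [set 1]).
- by apply: measurableI; exact: mitv.
- exact: measurable_set1.
- by move=> z /=; rewrite !in_itv/= => -[/andP[z1 _] /andP[_ z1']]; apply/le_anti/andP.
- exact: lebesgue_measure_set1.
Qed.

End primitive_lemmas.

Lemma primitive_sub (f h : R -> R) x : measurable_fun setT f -> (forall x, 0 <= f x <= 1) ->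
  measurable_fun setT h -> (forall x, 0 <= h x <= 1) ->
  primitive (fun t => f t - h t) x = primitive f x - primitive h x.
Proof.
move=> mf f01 mh h01.
have mx : measurable (`]-oo, x[%classic : set (measurableTypeR R)) by exact: measurable_itv.
have i1 (u : R -> R) : measurable_fun (setT : set (measurableTypeR R)) u ->
    (forall x, 0 <= u x <= 1) ->
    (segment_measure (-1) 1).-integrable `]-oo, x[ (EFin \o u).
  move=> mu u01; apply: (bounded_integrable _ mx (measurable_funTS mu) (c := 1)) => z _.
  by have /andP[u0 u1] := u01 z; rewrite ger0_norm.
by rewrite /primitive RintegralB//; exact: i1.
Qed.

(* A difference of 1-Lipschitz functions which is constant off [-1, 1] is
   controlled by its values on a grid. *)
Lemma grid_bound (D : R -> R) (k : nat) :
  (forall x y, x <= y -> `|D y - D x| <= y - x) ->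
  (forall x, x <= -1 -> D x = 0) -> (forall x, 1 <= x -> D x = D 1) ->
  (forall i : 'I_(k.+1).*2.+1, `|D (-1 + i%:R / k.+1%:R)| <= k.+1%:R^-1) ->
  forall x, `|D x| <= 2 * k.+1%:R^-1.
Proof.
move=> D1 DN1 DP1 Dg x.
have k0 : 0 < k.+1%:R :> R by rewrite ltr0n.
have k'0 : 0 <= k.+1%:R^-1 :> R by rewrite invr_ge0 ltW.
wlog x01 : x / -1 <= x <= 1 => [wl|].
  have [xN1|/ltW xN1] := leP x (-1); first by rewrite DN1// normr0 mulr_ge0.
  have [x1|/ltW x1] := leP x 1; first by apply: wl; rewrite xN1.
  by rewrite DP1//; apply: wl; rewrite lexx andbT; lra.
move: x01 => /andP[xN1 x1].
set j := Num.truncn ((x + 1) * k.+1%:R).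
have xk0 : 0 <= (x + 1) * k.+1%:R by rewrite mulr_ge0//; lra.
have jle : j%:R <= (x + 1) * k.+1%:R by rewrite truncn_le.
have jgt : (x + 1) * k.+1%:R < j.+1%:R by rewrite truncnS_gt.
have jk : (j < (k.+1).*2.+1)%N.
  rewrite ltnS -(ler_nat R) (le_trans jle)// -mul2n natrM ler_wpM2r//; lra.
have := Dg (Ordinal jk); rewrite /=; set p := -1 + _ => Dp.
have px : p <= x by rewrite /p addrC lerBlDr ler_pdivrMr.
have xp : x - p <= k.+1%:R^-1.
  have : x + 1 <= (j%:R + 1) / k.+1%:R by rewrite ler_pdivlMr// natr1 ltW.
  by rewrite mulrDl mul1r /p; move: (j%:R / _) => u; move: (_^-1) => v; lra.
rewrite -(subrK (D p) (D x)) mulr_natl mulr2n (le_trans (ler_normD _ _))// lerD//.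
exact: le_trans (D1 _ _ px) xp.
Qed.

End primitives.

(** * Uniform smallness of the cut norm, and compactness *)

Section compactness.
Context (R : realType) (m : nat).
Local Notation S := (sphere R m.+2).
Variable mu : probability S R.
Hypothesis inv : rotation_invariant mu.

Lemma cut_norm_small (e : R) : 0 < e -> exists k : nat, forall g : R -> R,
  measurable_fun setT g -> (forall t, `|g t| <= 1) ->
  (forall x, `|primitive g x| <= k.+1%:R^-1) ->
  cut_norm mu (spherical_kernel g) <= e.
Proof.
move=> e0; apply: contrapT => /forallNP H.
have /choice[g gP] : forall k : nat, exists g : R -> R, [/\ measurable_fun setT g,
    (forall t, `|g t| <= 1), (forall x, `|primitive g x| <= k.+1%:R^-1) &
    e < cut_norm mu (spherical_kernel g)].
  move=> k; apply: contrapT => /forallNP Hg; apply: (H k) => g mg g1 gk.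
  by rewrite leNgt; apply/negP => eg; apply: (Hg g).
have mg k : measurable_fun setT (g k) by have [] := gP k.
have g1 k : forall t, `|g k t| <= 1 by have [] := gP k.
have g0 x : primitive (g k) x @[k --> \oo] --> 0.
  apply/cvgr0Pnorm_le => d d0; exists (Num.truncn d^-1) => // k /= dk.
  have [_ _ /(_ x) gk _] := gP k; apply: (le_trans gk).
  rewrite invf_ple ?posrE ?ltr0n//.
  by rewrite (le_trans (ltW (truncnS_gt _)))// ler_nat.
(* The threshold inverts the bound of [cut_norm_le_gram], which is 4 times a square root. *)
have /cvgr0Pnorm_le/(_ ((e / 4) ^+ 2)) := gram_cvg0 inv mg g1 g0.
have e4 : 0 < e / 4 by rewrite divr_gt0.
case=> [|k _ /(_ k (leqnn k)) /= gk]; first by rewrite exprn_gt0.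
have [_ _ _] := gP k; rewrite ltNge => /negP; apply.
apply: (le_trans (cut_norm_le_gram mu (mg k) (g1 k))).
rewrite -ler_pdivlMl// mulrC -[leRHS]ger0_norm ?(ltW e4)// -sqrtr_sqr ler_wsqrtr//.
exact: le_trans (ler_norm _) gk.
Qed.

Let nu := (mu \x mu)%E.

Lemma cut_norm_ae_le (M N : S * S -> R) :
  nu.-integrable setT (EFin \o M) -> nu.-integrable setT (EFin \o N) ->
  {ae nu, forall z, M z = N z} -> cut_norm mu M <= cut_norm mu N.
Proof.
move=> iM iN MN; apply: cut_norm_le => f g tf tg.
have mM : measurable_fun setT M by apply/measurable_EFinP; exact: measurable_int iM.
have mN : measurable_fun setT N by apply/measurable_EFinP; exact: measurable_int iN.
have eqw (w : S * S -> R) : measurable_fun setT w ->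
    Rintegral nu setT (fun z => w z * M z) = Rintegral nu setT (fun z => w z * N z).
  move=> mw; congr fine; apply: ae_eq_integral => //.
  - by apply/measurable_EFinP; exact: measurable_funM.
  - by apply/measurable_EFinP; exact: measurable_funM.
  - by apply: filterS MN => z -> _.
have -> : cut_form mu M f g = cut_form mu N f g.
  rewrite !cut_formE; congr (_ +i* _); apply: eqw.
    exact: measurable_Re_wt tf tg.
  exact: measurable_Im_wt tf tg.
exact: le_cut_norm.
Qed.

(** Made total in [W] so that the axiom of choice gives one function for every kernel, 0 by default.
    Extending [f] by 0 off [-1, 1] makes the bounds hold on the whole line. *)
Lemma spherical_graphon_fun (W : L2_kernel mu) : exists f : R -> R,
  [/\ measurable_fun setT f, (forall t, 0 <= f t <= 1) &
   spherical_graphons mu W -> {ae nu, forall z, kernel_fun W z = spherical_kernel f z}].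
Proof.
have [[f [mf f01 Wf]]|nW] := pselect (spherical_graphons mu W); last first.
  by exists (cst 0); split => // t; rewrite lexx ler01.
exists (f \_ `[-1, 1]); split => [|t|_].
- by apply/(measurable_restrictT _ _).1 => //; exact: measurable_itv.
- by rewrite patchE; case: ifPn => [|_]; [rewrite inE => /f01|rewrite lexx ler01].
- apply: filterS Wf => z /(_ I) ->; rewrite /spherical_kernel patchE mem_set//.
  exact: dot_itv.
Qed.

Lemma spherical_graphons_compact : compact (spherical_graphons mu).
Proof.
rewrite compact_ultra => U UU US.
have /choice[f fP] := spherical_graphon_fun.
have mf W : measurable_fun setT (f W) by have [] := fP W.
have f01 W : forall t, 0 <= f W t <= 1 by have [] := fP W.
have fW W : spherical_graphons mu W ->
    {ae nu, forall z, kernel_fun W z = spherical_kernel (f W) z}.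
  by have [] := fP W.
have prim_itv W x : `[0, 2]%classic (primitive (f W) x).
  have [xN1|/ltW xN1] := leP x (-1).
    by rewrite primitive_le_N1//= in_itv/= lexx ler0n.
  wlog x1 : x xN1 / x <= 1 => [wl|].
    have [|/ltW x1] := leP x 1; first exact: wl.
    by rewrite primitive_ge1//; apply: wl; lra.
  have := primitive_lipschitz (mf W) (f01 W) xN1.
  by rewrite (primitive_le_N1 (mf W) (f01 W) (lexx _)) subr0/= in_itv/=; lra.
have /choice[F FP] : forall x : R, exists y : R, primitive (f W) x @[W --> U] --> y.
  move=> x; have [|y _ Uy] := @ultra_cvg_compact _ R^o U
      (fun W => primitive (f W) x) _ UU (@segment_compact R 0 2).
    by apply: filterS US => W _; exact: prim_itv.
  by exists y.
have UP : ProperFilter U by exact: ultra_proper.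
(* Closed bounds pass to the limit; this transfers to [F] the properties of primitives required by
   [primitive_density]. *)
have lim_itv (u : L2_kernel mu -> R) (l a b : R) :
    (forall W, a <= u W <= b) -> u W @[W --> U] --> l -> a <= l <= b.
  move=> uab ul; have cl : closed `[a, b]%classic by exact: itv_closed.
  have := closed_cvg _ cl _ l ul; rewrite /= in_itv/=; apply.
  by apply: nearW => W; rewrite in_itv/=.
have F1 x y : x <= y -> 0 <= F y - F x <= y - x.
  move=> xy; apply: (lim_itv (fun W => primitive (f W) y - primitive (f W) x)).
    by move=> W; exact: primitive_lipschitz.
  exact: (cvgB (FP y) (FP x)).
have FN1 x : x <= -1 -> F x = 0.
  move=> xN1; apply/eqP; rewrite eq_le andbC.
  apply: (lim_itv (fun W => primitive (f W) x) _ 0 0) => // W.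
  by rewrite primitive_le_N1// lexx.
have F_1 x : 1 <= x -> F x = F 1.
  move=> x1; apply/eqP; rewrite -subr_eq0 eq_le andbC.
  apply: (lim_itv (fun W => primitive (f W) x - primitive (f W) 1) _ 0 0).
    by move=> W; rewrite primitive_ge1// subrr lexx.
  exact: (cvgB (FP x) (FP 1)).
have [h [mh h01 hF]] := primitive_density F1 FN1 F_1.
have [|W0 W0h] := spherical_graphon_ex mu (measurable_funTS mh) (f := h).
  by move=> t _; exact: h01.
exists W0; split.
  by exists h; split => //; exact: measurable_funTS.
apply/cvg_ballP => e e0.
have e2 : 0 < e / 2 by rewrite divr_gt0.
have [k Hk] := cut_norm_small e2.
(* K + 1 = 2 (k + 1), so the bound 2 / (K + 1) of [grid_bound] is the 1 / (k + 1) demanded by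
   [cut_norm_small]. *)
pose K := k.*2.+1.
have K0 : 0 < K.+1%:R :> R by rewrite ltr0n.
(* A filter is closed under finite intersections only; hence a finite grid, from which the Lipschitz
   bound recovers all x. *)
have near_grid : \forall W \near U, forall i : 'I_(K.+1).*2.+1,
    `|F (-1 + i%:R / K.+1%:R) - primitive (f W) (-1 + i%:R / K.+1%:R)| <= K.+1%:R^-1.
  apply: filter_forall => i; have /cvgrPdist_le/(_ K.+1%:R^-1) := FP (-1 + i%:R / K.+1%:R).
  by rewrite invr_gt0 => /(_ K0).
apply: filterS2 US near_grid => W SW grid.
rewrite ballEmdist/=; apply: (@le_lt_trans _ _ (e / 2)); last by lra.
pose g t := h t - f W t.
have mg : measurable_fun setT g by exact: measurable_funB.
have g1 t : `|g t| <= 1.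
  by have := f01 W t; have := h01 t; rewrite ler_norml /g => /andP[? ?] /andP[? ?]; lra.
apply: (@le_trans _ _ (cut_norm mu (spherical_kernel g))).
  apply: (@cut_norm_ae_le (fun z => kernel_fun W0 z - kernel_fun W z)).
  - exact: integrable_L2B.
  - apply: (@bounded_integrable_prod _ _ _ _ _ mu mu _ 1) => [|z]; last exact: g1.
    exact: (measurableT_comp mg (@measurable_dot_prod R m.+2)).
  - apply: filterS2 W0h (fW W SW) => z W0z Wz.
    by rewrite (W0z I) Wz.
apply: Hk => // x.
have -> : k.+1%:R^-1 = 2 * K.+1%:R^-1 :> R.
  by rewrite /K -doubleS -mul2n natrM invfM mulrA divff ?mul1r// pnatr_eq0.
rewrite primitive_sub// [primitive h x]hF.
apply: (@grid_bound R (fun x => F x - primitive (f W) x)) => //.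
- move=> y z yz; have := primitive_lipschitz (mf W) (f01 W) yz; have := F1 _ _ yz.
  by rewrite ler_norml => /andP[? ?] /andP[? ?]; lra.
- by move=> y yN1; rewrite primitive_le_N1// FN1// subrr.
- by move=> y y1; rewrite primitive_ge1// F_1.
Qed.

End compactness.

Theorem proposition1p4 (R : realType) (n : nat) (mu : probability (sphere R n) R) :
  (2 <= n)%N -> rotation_invariant mu -> compact (spherical_graphons mu).
Proof.
case: n mu => [|[|m]] // mu _ inv; exact: spherical_graphons_compact.
Qed.
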